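(* Let $(H,\cdot)$ and $(N,+)$ be two ordered groups definable in an o-minimal structure, with $N$ abelian, and let $\gamma:H\to\operatorname{Aut}(N)$ be a definable group action of $H$ on $N$ such that for all $h\in H$ the map $\gamma(h)$ is an order preserving definable automorphism of $N$. Then there is a one-to-one correspondence between the elements of $H^2(H,N,\gamma)$ (classes of definable 2-cocycles) and the definable group extensions of $H$ by $N$ via $\gamma$ (up to equivalence of extensions) which, when endowed with the lexicographic order $<_l$ given first by $H$ and then by $N$, become ordered groups. (The correspondence sends the class of a 2-cocycle $c$ to the extension with underlying set $N\times H$ and operation $(a,g)\odot(b,h)=(a+\gamma(g)(b)+c(g,h),\,gh)$.)
   Context: ''Definable'' means definable in the fixed o-minimal structure (an o-minimal expansion of a real closed field); all groups, maps, actions, cochains and extensions are definable. An ordered group is a group with a definable linear order invariant under left and right translations. $\operatorname{Aut}(N)$ is the group of definable automorphisms of $N$; an action $\gamma$ is definable if $(h,a)\mapsto\gamma(h)(a)$ is definable. Cohomology: $C^n(H,N,\gamma)$ is the abelian group of definable functions $H^n\to N$ (with $C^0=N$), and $\delta:C^n\to C^{n+1}$ is $$\delta(f)(g_1,\dots,g_{n+1})=\gamma(g_1)(f(g_2,\dots,g_{n+1}))+\sum_{i=1}^n(-1)^if(g_1,\dots,g_ig_{i+1},\dots,g_{n+1})+(-1)^{n+1}f(g_1,\dots,g_n).$$ $Z^n=\ker(\delta:C^n\to C^{n+1})$ (cocycles), $B^n=\operatorname{im}(\delta:C^{n-1}\to C^n)$ for $n>0$ (and $B^0=0$), $H^n(H,N,\gamma)=Z^n/B^n$.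 An extension of $H$ by $N$ via $\gamma$ is a definable exact sequence $1\to N\xrightarrow{i}U\xrightarrow{\pi}H\to1$ such that, identifying $N$ with $i(N)$, $\gamma(h)(n)=gng^{-1}$ whenever $\pi(g)=h$. Two extensions $(U,i,\pi)$, $(U',i',\pi')$ are equivalent if there is a definable isomorphism $\varphi:U\to U'$ with $\varphi\circ i=i'$ and $\pi'\circ\varphi=\pi$. On $N\times H$ the lexicographic order is: $(b,h)<_l(d,j)$ iff $h<_Hj$, or $h=j$ and $b<_Nd$. *)

(* Defs.v *)
From HB Require Import structures.
From mathcomp Require Import all_boot all_order all_algebra.
From mathcomp Require Import ring_quotient.
From mathcomp Require Import all_classical.

Set Implicit Arguments.
Unset Strict Implicit.
Unset Printing Implicit Defensive.
Import GRing.Theory.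
Local Open Scope classical_set_scope.
Local Open Scope ring_scope.

(* An expansion of the real closed field R: an arbitrary family of extra
   function and relation symbols interpreted on R. *)
Record expansion (R : rcfType) := Expansion {
  fsym : Type;
  far : fsym -> nat;
  finterp : forall f : fsym, ('I_(far f) -> R) -> R;
  rsym : Type;
  rar : rsym -> nat;
  rinterp : forall r : rsym, ('I_(rar r) -> R) -> Prop }.

Section FirstOrder.
Variables (R : rcfType) (M : expansion R).

(* Parameters from R are allowed as constants. *)
Inductive term :=
| Var of nat
| Cst of R
| Add of term & term
| Opp of term
| Mul of term & term
| App (f : fsym M) of ('I_(far f) -> term).

(* [Ex] binds the de Bruijn index 0. *)
Inductive formula :=
| Eq of term & term
| Lt of term & term
| Rel (r : rsym M) of ('I_(rar r) -> term)
| Not of formula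
| And of formula & formula
| Ex of formula.

Fixpoint eval (e : nat -> R) (t : term) : R :=
  match t with
  | Var i => e i
  | Cst a => a
  | Add t u => eval e t + eval e u
  | Opp t => - eval e t
  | Mul t u => eval e t * eval e u
  | App f ts => finterp (fun i => eval e (ts i))
  end.

Definition scons (a : R) (e : nat -> R) (i : nat) : R :=
  if i is j.+1 then e j else a.

Fixpoint sat (e : nat -> R) (phi : formula) : Prop :=
  match phi with
  | Eq t u => eval e t = eval e u
  | Lt t u => eval e t < eval e u
  | Rel r ts => rinterp (fun i => eval e (ts i))
  | Not phi => ~ sat e phi
  | And phi psi => sat e phi /\ sat e psi
  | Ex phi => exists a, sat (scons a e) phi
  end.

(* The value 0 given to the indices i >= n is immaterial, as parameters are
   allowed. *)
Definition env n (x : 'rV[R]_n) (i : nat) : R :=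
  if insub i is Some j then x 0 j else 0.

Definition definable n (X : set 'rV[R]_n) : Prop :=
  exists phi, forall x, X x <-> sat (env x) phi.

(* [interval R] contains the open, half-open and closed intervals with endpoints
   in R or infinite, hence also the points [a, a]. *)
Definition o_minimal : Prop :=
  forall X : set 'rV[R]_1, definable X ->
    exists s : seq (interval R), X = [set x | has (fun I => x 0 0 \in I) s].

Fixpoint tren (r : nat -> nat) (t : term) : term :=
  match t with
  | Var i => Var (r i)
  | Cst a => Cst a
  | Add t u => Add (tren r t) (tren r u)
  | Opp t => Opp (tren r t)
  | Mul t u => Mul (tren r t) (tren r u)
  | App f ts => App (fun i => tren r (ts i))
  end.

Definition up (r : nat -> nat) (i : nat) : nat :=
  if i is j.+1 then (r j).+1 else 0.

Fixpoint fren (r : nat -> nat) (phi : formula) : formula :=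
  match phi with
  | Eq t u => Eq (tren r t) (tren r u)
  | Lt t u => Lt (tren r t) (tren r u)
  | Rel r' ts => Rel (fun i => tren r (ts i))
  | Not phi => Not (fren r phi)
  | And phi psi => And (fren r phi) (fren r psi)
  | Ex phi => Ex (fren (up r) phi)
  end.

Lemma eval_ren r e t : eval e (tren r t) = eval (e \o r) t.
Proof.
elim: t => //= [t -> u -> | t -> | t -> u -> | f ts IH] //.
by congr finterp; apply/funext => i; rewrite IH.
Qed.

Lemma sat_ren phi r e : sat e (fren r phi) <-> sat (e \o r) phi.
Proof.
elim: phi r e => /= [t u|t u|r' ts|phi IH|phi IH psi IH'|phi IH] r e.
- by rewrite !eval_ren.
- by rewrite !eval_ren.
- by under eq_fun do rewrite eval_ren.
- by rewrite IH.
- by rewrite IH IH'.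
- suff E a : scons a e \o up r = scons a (e \o r).
    by split=> -[a]; [rewrite IH E | rewrite -E -IH]; exists a.
  by apply/funext => -[].
Qed.

Lemma env_ord n (x : 'rV_n) (j : 'I_n) : env x j = x 0 j.
Proof. by rewrite /env valK. Qed.

Lemma env_ge n (x : 'rV_n) i : (n <= i)%N -> env x i = 0.
Proof. by move=> le; rewrite /env insubF // ltnNge le. Qed.

Lemma definableC n (X : set 'rV_n) : definable X -> definable (~` X).
Proof. by case=> phi P; exists (Not phi) => x; rewrite /= -P. Qed.

Lemma definableI n (X Y : set 'rV_n) :
  definable X -> definable Y -> definable (X `&` Y).
Proof.
by case=> phi P [psi Q]; exists (And phi psi) => x; rewrite /= -P -Q.
Qed.

Lemma definableT n : definable [set: 'rV_n].
Proof. by exists (Eq (Cst 0) (Cst 0)). Qed.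

Lemma definable_forall n k (X : 'I_k -> set 'rV_n) :
  (forall i, definable (X i)) -> definable [set x | forall i, X i x].
Proof.
elim: k X => [|k IH] X dX.
  suff -> : [set x | forall i, X i x] = setT by apply: definableT.
  by apply/seteqP; split => // x _ [].
have -> : [set x | forall i, X i x] =
    X ord0 `&` [set x | forall i, X (lift ord0 i) x].
  apply/seteqP; split => x /=; first by move=> h; split=> [|i]; apply: h.
  by case=> h0 hS i; case: (unliftP ord0 i) => [j|] ->.
by apply: definableI => //; apply: IH => i.
Qed.

Lemma definable_eq_coord n (i j : 'I_n) : definable [set x | x 0 i = x 0 j].
Proof. by exists (Eq (Var i) (Var j)) => x; rewrite /= !env_ord. Qed.

Lemma definable_eq_cst n (i : 'I_n) a : definable [set x | x 0 i = a].
Proof. by exists (Eq (Var i) (Cst a)) => x; rewrite /= !env_ord. Qed.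

Lemma definable_reindex m n (rho : 'I_m -> 'I_n) (X : set 'rV_m) :
  definable X -> definable [set x : 'rV_n | X (\row_i x 0 (rho i))].
Proof.
case=> phi P.
pose r i : nat := if insub i is Some j then rho j else n.
exists (fren r phi) => x /=; rewrite P sat_ren.
suff -> : env (\row_i x 0 (rho i)) = env x \o r by [].
apply/funext => i /=; case: (ltnP i m) => [lt|le].
  by rewrite -[i]/(val (Ordinal lt)) env_ord mxE /r valK env_ord.
by rewrite env_ge // /r insubF ?env_ge // ltnNge le.
Qed.

Definition scat n (y : 'rV[R]_n) (e : nat -> R) (i : nat) : R :=
  if insub i is Some j then y 0 j else e (i - n)%N.

Lemma scat_ord n (y : 'rV_n) e (j : 'I_n) : scat y e j = y 0 j.
Proof. by rewrite /scat valK. Qed.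

Lemma scat_ge n (y : 'rV_n) e i : (n <= i)%N -> scat y e i = e (i - n)%N.
Proof. by move=> le; rewrite /scat insubF // ltnNge le. Qed.

Lemma sat_exn n phi e :
  sat e (iter n Ex phi) <-> exists y : 'rV_n, sat (scat y e) phi.
Proof.
have S0 (y : 'rV_0) : scat y e = e.
  by apply/funext => i; rewrite scat_ge // subn0.
have SS k (y : 'rV_k) a :
    scons a (scat y e) = scat (row_mx (a%:M : 'rV_1) y : 'rV_k.+1) e.
  apply/funext => -[|i] /=.
    rewrite (scat_ord _ e (lshift k (ord0 : 'I_1))) row_mxEl.
    by rewrite mxE.
  case: (ltnP i k) => [lt|le]; last by rewrite !scat_ge // subSS.
  rewrite -[i]/(val (Ordinal lt)) scat_ord.
  by rewrite (scat_ord _ e (rshift 1 (Ordinal lt))) row_mxEr.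
elim: n phi => [|n IH] phi.
  by split=> [h|[y]]; [exists 0; rewrite S0 | rewrite S0].
rewrite iterSr IH; split => [[y [a]]|[y]].
  by rewrite SS; exists (row_mx a%:M y).
move=> h; exists (rsubmx (y : 'rV_(1 + n))), (lsubmx (y : 'rV_(1 + n)) 0 0).
by rewrite SS -mx11_scalar hsubmxK.
Qed.

Lemma definable_proj m n (X : set 'rV_(m + n)) :
  definable X -> definable [set x : 'rV_m | exists y, X (row_mx x y)].
Proof.
case=> phi P.
pose r i := if (i < m)%N then (n + i)%N else if (i < m + n)%N then (i - m)%N else i.
exists (iter n Ex (fren r phi)) => x /=; rewrite sat_exn.
suff E (y : 'rV_n) : env (row_mx x y) = scat y (env x) \o r.
  by split=> -[y] h; exists y; move: h; rewrite sat_ren P E.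
apply/funext => i /=; rewrite /r; case: (ltnP i m) => [lt|le].
  rewrite scat_ge ?leq_addr // addKn -[i]/(val (Ordinal lt)) env_ord.
  by rewrite (env_ord _ (lshift n (Ordinal lt))) row_mxEl.
case: (ltnP i (m + n)) => [lt2|le2].
  have lt : (i - m < n)%N by rewrite ltn_subLR.
  rewrite -[(i - m)%N]/(val (Ordinal lt)) scat_ord.
  have {1}-> : i = rshift m (Ordinal lt) by rewrite /= subnKC.
  by rewrite env_ord row_mxEr.
by rewrite env_ge // scat_ge ?env_ge // ?leq_subRL // ?(addnC n) // (leq_trans _ le2) ?leq_addl.
Qed.

End FirstOrder.

(* A definable set, up to an injective encoding of its elements as points of
   some R^ddim; only the image of the encoding has to be definable. *)
HB.mixin Record isDefinable (R : rcfType) (M : expansion R) (T : Type) := {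
  ddim : nat;
  demb : T -> 'rV[R]_ddim;
  demb_inj : injective demb;
  definable_range : definable M (range demb) }.

#[short(type="definableType")]
HB.structure Definition Definable (R : rcfType) (M : expansion R) :=
  {T of Choice T & isDefinable R M T}.

Arguments ddim {R M} s.
Arguments demb_inj {R M s} [x1 x2].

Section DefinableSets.
Variables (R : rcfType) (M : expansion R).
Implicit Types T : definableType M.

Definition definable_set T (A : set T) : Prop := definable M (demb @` A).

Definition coord_map T T' (p : T -> T') : Prop :=
  exists rho : 'I_(ddim T') -> 'I_(ddim T),
    forall t i, demb (p t) 0 i = demb t 0 (rho i).

Lemma definable_set_pull T n (f : T -> 'rV_n) (rho : 'I_n -> 'I_(ddim T))
    (X : set 'rV_n) :
  (forall t i, f t 0 i = demb t 0 (rho i)) -> definable M X ->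
  definable_set (f @^-1` X).
Proof.
move=> E dX; rewrite /definable_set.
have -> : demb @` (f @^-1` X) = range demb `&` [set x | X (\row_i x 0 (rho i))].
  have Er t : (\row_i demb t 0 (rho i)) = f t.
    by apply/rowP => i; rewrite mxE E.
  apply/seteqP; split=> [x [t Xt <-]|x [[t _ <-]]] /=; last first.
    by rewrite Er => h; exists t.
  by split; [exists t | rewrite Er].
by apply: definableI; [exact: definable_range | exact: definable_reindex].
Qed.

Lemma definable_set_preim_coord T T' (p : T -> T') (A : set T') :
  coord_map p -> definable_set A -> definable_set (p @^-1` A).
Proof.
move=> [rho E] dA.
have -> : p @^-1` A = (demb \o p) @^-1` (demb @` A).
  apply/seteqP; split=> t /=; first by exists (p t).
  by case=> t' At' /demb_inj <-.
exact: (@definable_set_pull T _ (demb \o p) rho).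
Qed.

Lemma definable_setC T (A : set T) : definable_set A -> definable_set (~` A).
Proof.
move=> dA; rewrite /definable_set.
have -> : demb @` (~` A) = range (@demb _ _ T) `&` ~` (demb @` A).
  apply/seteqP; split=> [x [t At <-]|x [[t _ <-] h]].
    by split; [exists t | case=> t' At' /demb_inj e; apply: At; rewrite -e].
  by exists t => // At; apply: h; exists t.
by apply: definableI; [exact: definable_range | exact: definableC].
Qed.

Lemma definable_setI T (A B : set T) :
  definable_set A -> definable_set B -> definable_set (A `&` B).
Proof.
move=> dA dB; rewrite /definable_set.
have -> : demb @` (A `&` B) = (demb @` A) `&` (demb @` B).
  apply/seteqP; split=> [x [t [At Bt] <-]|x [[t At <-] [t' Bt' /demb_inj e]]].
    by split; exists t.
  by exists t => //; split=> //; rewrite -e.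
exact: definableI.
Qed.

Lemma definable_setT T : definable_set [set: T].
Proof. exact: definable_range. Qed.

Lemma definable_set_forall T k (A : 'I_k -> set T) :
  (forall i, definable_set (A i)) -> definable_set [set x | forall i, A i x].
Proof.
move=> dA; rewrite /definable_set.
have -> : demb @` [set x | forall i, A i x] =
    range (@demb _ _ T) `&` [set x | forall i, (demb @` A i) x].
  apply/seteqP; split=> [x [t At <-]|x [[t _ <-] h]].
    by split; [exists t | move=> i; exists t].
  by exists t => // i; case: (h i) => t' At' /demb_inj <-.
apply: definableI; first exact: definable_range.
exact: definable_forall.
Qed.

Lemma definable_set1 T (c : T) : definable_set [set c].
Proof.
rewrite /definable_set.
have -> : demb @` [set c] = [set x | forall i, x 0 i = demb c 0 i].
  apply/seteqP; split=> [x [t -> <-]|x h] //.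
  by exists c => //; apply/rowP => i; rewrite h.
by apply: definable_forall => i; exact: definable_eq_cst.
Qed.

Lemma definable_set_eq_coord T T' (p q : T -> T') :
  coord_map p -> coord_map q -> definable_set [set t | p t = q t].
Proof.
move=> [rho E] [rho' E'].
have -> : [set t | p t = q t] =
    [set t : T | forall i, demb t 0 (rho i) = demb t 0 (rho' i)].
  apply/seteqP; split=> t /=; first by move=> h i; rewrite -E -E' h.
  by move=> h; apply/demb_inj/rowP => i; rewrite E E'.
apply: (@definable_set_forall T _ (fun i => [set t : T | demb t 0 (rho i) = demb t 0 (rho' i)])) => i.
pose f (t : T) : 'rV[R]_2 :=
  \row_(k < 2) if k == 0 then demb t 0 (rho i) else demb t 0 (rho' i).
have -> : [set t : T | demb t 0 (rho i) = demb t 0 (rho' i)] =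
    f @^-1` [set x | x 0 (0 : 'I_2) = x 0 1].
  by apply/seteqP; split=> t /=; rewrite !mxE.
apply: (@definable_set_pull _ _ f (fun k => if k == 0 then rho i else rho' i)).
  by move=> t k; rewrite mxE; case: ifP.
exact: definable_eq_coord.
Qed.

Section Prod.
Variables T1 T2 : definableType M.

Definition prod_demb (p : T1 * T2) : 'rV[R]_(ddim T1 + ddim T2) :=
  row_mx (demb p.1) (demb p.2).

Lemma prod_demb_inj : injective prod_demb.
Proof. by move=> [a b] [c d] /eq_row_mx[/demb_inj /= -> /demb_inj /= ->]. Qed.

Lemma prod_definable_range : definable M (range prod_demb).
Proof.
have -> : range prod_demb =
   [set x | range (@demb _ _ T1) (\row_i x 0 (lshift (ddim T2) i))] `&`
   [set x | range (@demb _ _ T2) (\row_i x 0 (rshift (ddim T1) i))].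
  apply/seteqP; split=> [x [[a b] _ <-]|x [[a _ ea] [b _ eb]]].
    by split; [exists a | exists b] => //; apply/rowP => i;
      rewrite mxE ?row_mxEl ?row_mxEr.
  exists (a, b) => //; rewrite /prod_demb /= ea eb -[x in RHS]hsubmxK.
  by congr row_mx; apply/rowP => i; rewrite !mxE.
by apply: definableI; apply: definable_reindex; exact: definable_range.
Qed.

HB.instance Definition _ :=
  isDefinable.Build R M (T1 * T2)%type prod_demb_inj prod_definable_range.

End Prod.

Section Tuple.
Variables (n : nat) (T : definableType M).

Definition tuple_demb (t : n.-tuple T) : 'rV[R]_(n * ddim T) :=
  mxvec (\matrix_(i < n) demb (tnth t i)).

Lemma tuple_dembE t i j : tuple_demb t 0 (mxvec_index i j) = demb (tnth t i) 0 j.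
Proof. by rewrite /tuple_demb mxvecE !mxE. Qed.

Lemma tuple_demb_inj : injective tuple_demb.
Proof.
move=> s t e; apply/eq_from_tnth => i; apply/demb_inj/rowP => j.
by rewrite -!tuple_dembE e.
Qed.

Lemma tuple_definable_range : definable M (range tuple_demb).
Proof.
have -> : range tuple_demb = [set x | forall i : 'I_n,
    range (@demb _ _ T) (\row_j x 0 (mxvec_index i j))].
  apply/seteqP; split=> [x [t _ <-] i|x /= h].
    by exists (tnth t i) => //; apply/rowP => j; rewrite mxE tuple_dembE.
  have /choice [t et] : forall i, exists t : T,
      demb t = \row_j x 0 (mxvec_index i j).
    by move=> i; have [t _ et] := h i; exists t.
  exists [tuple t i | i < n] => //; apply/rowP => k.
  by case/mxvec_indexP: k => i j; rewrite tuple_dembE tnth_mktuple et mxE.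
apply: definable_forall => i; apply: definable_reindex; exact: definable_range.
Qed.

HB.instance Definition _ :=
  isDefinable.Build R M (n.-tuple T) tuple_demb_inj tuple_definable_range.

End Tuple.

Lemma definable_set_proj T1 T2 (A : set (T1 * T2)) :
  definable_set A -> definable_set [set x | exists y, A (x, y)].
Proof.
move=> dA; rewrite /definable_set.
have -> : demb @` [set x | exists y, A (x, y)] =
    [set x | exists y, (demb @` A) (row_mx x y)].
  apply/seteqP; split=> [x [t [y Aty] <-]|x [y [[a b] Aab /eq_row_mx[<- _]]]].
    by exists (demb y), (t, y).
  by exists a => //; exists b.
exact: definable_proj.
Qed.

Definition definable_map T1 T2 (f : T1 -> T2) : Prop :=
  definable_set [set p : T1 * T2 | f p.1 = p.2].

Lemma coord_comp T1 T2 T3 (g : T2 -> T3) (f : T1 -> T2) :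
  coord_map g -> coord_map f -> coord_map (g \o f).
Proof. by case=> r E [s E']; exists (s \o r) => t i /=; rewrite E E'. Qed.

Lemma coord_id T : coord_map (@id T).
Proof. by exists id. Qed.

Lemma coord_fst T1 T2 : coord_map (@fst T1 T2).
Proof.
by exists (lshift _) => -[a b] i; rewrite /demb /= /prod_demb row_mxEl.
Qed.

Lemma coord_snd T1 T2 : coord_map (@snd T1 T2).
Proof.
by exists (fun j => rshift (ddim T1) j) => -[a b] i; rewrite /demb /= /prod_demb row_mxEr.
Qed.

Lemma coord_pair T T1 T2 (f : T -> T1) (g : T -> T2) :
  coord_map f -> coord_map g -> coord_map (fun t => (f t, g t)).
Proof.
case=> r E [s E'].
exists (fun i : 'I_(ddim T1 + ddim T2) => match fintype.split i with inl j => r j | inr j => s j end) => t i.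
rewrite [demb (f t, g t)]/(prod_demb (f t, g t)) /prod_demb mxE /=.
by case: (fintype.split i) => j; rewrite ?E ?E'.
Qed.

Lemma coord_tnth n T (i : 'I_n) : coord_map (fun t : n.-tuple T => tnth t i).
Proof.
exists (mxvec_index i) => t j.
by rewrite [demb t]/(tuple_demb t) tuple_dembE.
Qed.

Lemma definable_set_preim T1 T2 (f : T1 -> T2) (A : set T2) :
  definable_map f -> definable_set A -> definable_set (f @^-1` A).
Proof.
move=> df dA.
have -> : f @^-1` A =
    [set x | exists y, ([set p | f p.1 = p.2] `&` (snd @^-1` A)) (x, y)].
  apply/seteqP; split=> x /=; first by exists (f x).
  by case=> y [->].
apply: definable_set_proj; apply: definable_setI => //.
by apply: definable_set_preim_coord => //; exact: coord_snd.
Qed.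

Lemma definable_coord T1 T2 (p : T1 -> T2) : coord_map p -> definable_map p.
Proof.
move=> dp; apply: (@definable_set_eq_coord _ _ (p \o fst) snd).
  by apply: coord_comp => //; exact: coord_fst.
exact: coord_snd.
Qed.

Lemma definable_cst T1 T2 (c : T2) : definable_map (fun _ : T1 => c).
Proof.
rewrite /definable_map.
have -> : [set p : T1 * T2 | c = p.2] = snd @^-1` [set c].
  by apply/seteqP; split=> p /=.
apply: definable_set_preim_coord; first exact: coord_snd.
exact: definable_set1.
Qed.

Lemma definable_comp T1 T2 T3 (g : T2 -> T3) (f : T1 -> T2) :
  definable_map g -> definable_map f -> definable_map (fun x => g (f x)).
Proof.
move=> dg df; rewrite /definable_map.
have -> : [set p : T1 * T3 | g (f p.1) = p.2] =
  (fun p : T1 * T3 => f p.1) @^-1` setT `&`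
  [set p | exists y, ((fun q : T1 * T3 * T2 => (q.1.1, q.2)) @^-1`
      [set p | f p.1 = p.2] `&`
     (fun q : T1 * T3 * T2 => (q.2, q.1.2)) @^-1`
      [set p | g p.1 = p.2]) (p, y)].
  apply/seteqP; split=> -[x z] /=; first by move=> <-; split=> //; exists (f x).
  by case=> _ [y [->]].
apply: definable_setI.
  rewrite preimage_setT; exact: definable_setT.
apply: definable_set_proj; apply: definable_setI;
  apply: definable_set_preim_coord => //; apply: coord_pair.
- by apply: coord_comp (@coord_fst _ _) (@coord_fst _ _).
- exact: coord_snd.
- exact: coord_snd.
- by apply: coord_comp (@coord_snd _ _) (@coord_fst _ _).
Qed.

Lemma definable_pair T T1 T2 (f : T -> T1) (g : T -> T2) :
  definable_map f -> definable_map g -> definable_map (fun t => (f t, g t)).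
Proof.
move=> df dg; rewrite /definable_map.
have -> : [set p : T * (T1 * T2) | (f p.1, g p.1) = p.2] =
  (fun p => (p.1, p.2.1)) @^-1` [set p | f p.1 = p.2] `&`
  (fun p => (p.1, p.2.2)) @^-1` [set p | g p.1 = p.2].
  by apply/seteqP; split=> -[t [a b]] /= [-> ->].
by apply: definable_setI; apply: definable_set_preim_coord => //;
  apply: coord_pair; [exact: coord_fst | | exact: coord_fst | ];
  apply: coord_comp (@coord_snd _ _); [exact: coord_fst | exact: coord_snd].
Qed.

Lemma definable_id T : definable_map (@id T).
Proof. by apply: definable_coord; exact: coord_id. Qed.

Lemma definable_fst T1 T2 : definable_map (@fst T1 T2).
Proof. by apply: definable_coord; exact: coord_fst. Qed.

Lemma definable_snd T1 T2 : definable_map (@snd T1 T2).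
Proof. by apply: definable_coord; exact: coord_snd. Qed.

Lemma definable_tnth n T (i : 'I_n) :
  definable_map (fun t : n.-tuple T => tnth t i).
Proof. by apply: definable_coord; exact: coord_tnth. Qed.

Lemma definable_mktuple n T1 T2 (f : T1 -> 'I_n -> T2) :
  (forall i, definable_map (f^~ i)) ->
  definable_map (fun x => [tuple f x i | i < n]).
Proof.
move=> df; rewrite /definable_map.
have -> : [set p : T1 * n.-tuple T2 | [tuple f p.1 i | i < n] = p.2] =
  [set p | forall i, ((fun p : T1 * n.-tuple T2 => (p.1, tnth p.2 i)) @^-1`
     [set q | f q.1 i = q.2]) p].
  apply/seteqP; split=> -[x t] /=; first by move=> <- i; rewrite tnth_mktuple.
  by move=> h; apply/eq_from_tnth => i; rewrite tnth_mktuple.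
apply: (@definable_set_forall _ _ (fun i =>
  (fun p : T1 * n.-tuple T2 => (p.1, tnth p.2 i)) @^-1`
     [set q | f q.1 i = q.2])) => i.
apply: definable_set_preim_coord (df i).
apply: coord_pair; first exact: coord_fst.
by apply: coord_comp (@coord_tnth _ _ _) (@coord_snd _ _).
Qed.

End DefinableSets.

HB.mixin Record Group_isDefinableGroup (R : rcfType) (M : expansion R) G
    of Group G & isDefinable R M G := {
  definable_mulg : definable_map (fun p : G * G => (p.1 * p.2)%g) }.

#[short(type="definableGroupType")]
HB.structure Definition DefinableGroup (R : rcfType) (M : expansion R) :=
  {G of Group G & isDefinable R M G & Group_isDefinableGroup R M G}.

HB.mixin Record Zmodule_isDefinableZmodule (R : rcfType) (M : expansion R) V
    of GRing.Zmodule V & isDefinable R M V := {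
  definable_addr : definable_map (fun p : V * V => p.1 + p.2) }.

#[short(type="definableZmodType")]
HB.structure Definition DefinableZmodule (R : rcfType) (M : expansion R) :=
  {V of GRing.Zmodule V & isDefinable R M V & Zmodule_isDefinableZmodule R M V}.

Record definable_automorphism (R : rcfType) (M : expansion R)
    (N : definableZmodType M) := DefinableAutomorphism {
  daut_fun :> {additive N -> N};
  daut_bij : bijective daut_fun;
  daut_definable : definable_map daut_fun }.

Record definable_action (R : rcfType) (M : expansion R)
    (H : definableGroupType M) (N : definableZmodType M) := DefinableAction {
  dact :> H -> definable_automorphism N;
  dactM : forall g h a, dact (g * h)%g a = dact g (dact h a);
  dact_definable : definable_map (fun p : H * N => dact p.1 p.2) }.

(* [lt] is the strict order; [op] is the group law, so that the definition
   applies to multiplicative and to additive groups. *)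
Record group_order (R : rcfType) (M : expansion R) (G : definableType M)
    (op : G -> G -> G) (lt : G -> G -> Prop) : Prop := GroupOrder {
  order_irr : forall x, ~ lt x x;
  order_trans : forall x y z, lt x y -> lt y z -> lt x z;
  order_total : forall x y, [\/ lt x y, x = y | lt y x];
  order_mull : forall z x y, lt x y -> lt (op z x) (op z y);
  order_mulr : forall z x y, lt x y -> lt (op x z) (op y z);
  order_definable : definable_set [set p : G * G | lt p.1 p.2] }.

Definition ordered_group (R : rcfType) (M : expansion R)
  (G : definableGroupType M) (lt : G -> G -> Prop) : Prop :=
  group_order (fun x y : G => (x * y)%g) lt.

Definition ordered_zmodule (R : rcfType) (M : expansion R)
  (V : definableZmodType M) (lt : V -> V -> Prop) : Prop :=
  group_order (fun x y : V => x + y) lt.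

Section Cohomology.
Variables (R : rcfType) (M : expansion R).
Variables (H : definableGroupType M) (N : definableZmodType M).

Section DefinableMaps.
Variable T : definableType M.
Implicit Types f g : T -> N.

Lemma definable_map_add f g :
  definable_map f -> definable_map g -> definable_map (f + g).
Proof.
by move=> df dg; apply: (definable_comp (@definable_addr _ _ N) (definable_pair df dg)).
Qed.

Lemma definable_map_opp f : definable_map f -> definable_map (- f).
Proof.
have dopp : definable_map (fun x : N => - x).
  rewrite /definable_map.
  have -> : [set p : N * N | - p.1 = p.2] =
      (fun p : N * N => p.1 + p.2) @^-1` [set 0].
    apply/seteqP; split=> -[a b] /=; first by move=> <-; rewrite subrr.
    by move/eqP; rewrite addr_eq0 => /eqP ->; rewrite opprK.
  by apply: definable_set_preim (@definable_addr _ _ N) (definable_set1 _).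
by move=> df; apply: (definable_comp dopp df).
Qed.

Lemma definable_map_sum k (F : 'I_k -> T -> N) :
  (forall i, definable_map (F i)) ->
  definable_map (fun x => \sum_(i < k) F i x).
Proof.
elim: k F => [|k IH] F dF.
  under eq_fun do rewrite big_ord0; exact: definable_cst.
under eq_fun do rewrite big_ord_recl.
by apply: definable_map_add => //; apply: IH.
Qed.

Lemma definable_map_sign f k :
  definable_map f -> definable_map (fun x => f x *~ (-1) ^+ k).
Proof.
move=> df; rewrite -signr_odd; case: (odd k); rewrite ?expr1 ?expr0.
  under eq_fun do rewrite mulrN1z; exact: definable_map_opp.
by under eq_fun do rewrite mulr1z.
Qed.

End DefinableMaps.

Section Cochain.
Variable n : nat.

Definition definable_mapb : {pred n.-tuple H -> N} := fun f => `[< definable_map f >].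

Lemma definable_mapb_zmod : zmod_closed definable_mapb.
Proof.
split=> [|f g]; first by apply/asboolP; exact: definable_cst.
move=> /asboolP df /asboolP dg; apply/asboolP.
by apply: definable_map_add => //; exact: definable_map_opp.
Qed.

HB.instance Definition _ :=
  GRing.isZmodClosed.Build _ definable_mapb definable_mapb_zmod.

(* In degree 0, n.-tuple H is a singleton and a cochain is an element of N. *)
Record cochain := Cochain {
  cochain_fun :> n.-tuple H -> N;
  _ : cochain_fun \in definable_mapb }.

HB.instance Definition _ := [isSub for cochain_fun].
HB.instance Definition _ := [Choice of cochain by <:].
HB.instance Definition _ := [SubChoice_isSubZmodule of cochain by <:].

Lemma cochain_definable (f : cochain) : definable_map f.
Proof. by case: f => f /= fP; apply/asboolP. Qed.

End Cochain.

Variable gamma : definable_action H N.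

(* [contract i g] multiplies the entries i and i+1 (counted from 0) of g. *)
Definition contract n (i : 'I_n) (g : n.+1.-tuple H) : n.-tuple H :=
  [tuple if (j < i)%N then tnth g (widen_ord (leqnSn n) j)
         else if j == i then
           (tnth g (widen_ord (leqnSn n) j) * tnth g (lift ord0 j))%g
         else tnth g (lift ord0 j) | j < n].

Definition drop_first n (g : n.+1.-tuple H) : n.-tuple H :=
  [tuple tnth g (lift ord0 j) | j < n].

Definition drop_last n (g : n.+1.-tuple H) : n.-tuple H :=
  [tuple tnth g (widen_ord (leqnSn n) j) | j < n].

Definition delta_fun n (f : n.-tuple H -> N) (g : n.+1.-tuple H) : N :=
  gamma (tnth g ord0) (f (drop_first g))
  + \sum_(i < n) f (contract i g) *~ (-1) ^+ i.+1
  + f (drop_last g) *~ (-1) ^+ n.+1.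

Lemma delta_definable n (f : cochain n) : delta_fun f \in @definable_mapb n.+1.
Proof.
apply/asboolP; have df := cochain_definable f.
apply: definable_map_add; first apply: definable_map_add.
- apply: (definable_comp (dact_definable gamma)
    (f := fun g => (tnth g ord0, f (drop_first g)))).
  apply: definable_pair; first exact: definable_tnth.
  apply: (definable_comp df); apply: definable_mktuple => i.
  exact: definable_tnth.
- apply: definable_map_sum => i; apply: definable_map_sign.
  apply: (definable_comp df); apply: definable_mktuple => j.
  case: (j < i)%N; first exact: definable_tnth.
  case: (j == i); last exact: definable_tnth.
  apply: (definable_comp (@definable_mulg _ _ H)
    (f := fun g => (tnth g (widen_ord (leqnSn n) j), tnth g (lift ord0 j)))).
  by apply: definable_pair; exact: definable_tnth.
- apply: definable_map_sign; apply: (definable_comp df).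
  by apply: definable_mktuple => i; exact: definable_tnth.
Qed.

Definition delta n (f : cochain n) : cochain n.+1 := Cochain (delta_definable f).

Lemma delta_is_zmod_morphism n : zmod_morphism (@delta n).
Proof.
have cochainB k (u v : cochain k) t : (u - v) t = u t - v t by [].
move=> f g; apply/val_inj/funext => t.
rewrite -[LHS]/(delta_fun (f - g) t) -[RHS]/(delta_fun f t - delta_fun g t).
rewrite /delta_fun !cochainB raddfB mulrzBl.
under eq_bigr do rewrite cochainB mulrzBl.
by rewrite sumrB !opprD !addrA [LHS](ACl (1*3*5*2*4*6)).
Qed.

HB.instance Definition _ n :=
  GRing.isZmodMorphism.Build _ _ (@delta n) (@delta_is_zmod_morphism n).

Section Quotient.
Variable n : nat.

Definition delta_kernel : {pred cochain n} := fun f => delta f == 0.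

Lemma delta_kernel_zmod : zmod_closed delta_kernel.
Proof.
split=> [|f g]; rewrite !unfold_in /delta_kernel ?raddf0 //.
by move=> /eqP zf /eqP zg; rewrite raddfB /= zf zg subrr.
Qed.

HB.instance Definition _ :=
  GRing.isZmodClosed.Build _ delta_kernel delta_kernel_zmod.

Record cocycle := Cocycle {
  cocycle_cochain :> cochain n;
  _ : cocycle_cochain \in delta_kernel }.

HB.instance Definition _ := [isSub for cocycle_cochain].
HB.instance Definition _ := [Choice of cocycle by <:].
HB.instance Definition _ := [SubChoice_isSubZmodule of cocycle by <:].

Lemma delta_cocycle (f : cocycle) : delta f = 0.
Proof. by case: f => f /= fP; apply/eqP. Qed.

End Quotient.

(* For n > 0 the image of delta is contained in its kernel, so that no coboundary
   is lost by defining B^n inside the type of cocycles. *)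
Definition delta_image n : cochain n -> Prop :=
  match n with
  | 0 => fun f => f = 0
  | m.+1 => fun f => exists g : cochain m, f = delta g
  end.

Definition coboundary n : {pred cocycle n} := fun f => `[< delta_image f >].
Arguments coboundary n : clear implicits.

Lemma coboundary_zmod n : zmod_closed (coboundary n).
Proof.
split=> [|f g].
  by apply/asboolP; case: n => [|n] //=; exists 0; rewrite raddf0.
move=> /asboolP df /asboolP dg; apply/asboolP.
case: n f g df dg => [|n] f g /=; first by move=> -> ->; rewrite subr0.
by move=> [f' ->] [g' ->]; exists (f' - g'); rewrite raddfB.
Qed.

HB.instance Definition _ n :=
  GRing.isZmodClosed.Build _ (coboundary n) (@coboundary_zmod n).

Definition cohomology n : Type := Quotient.quot (coboundary n).
HB.instance Definition _ n := GRing.Zmodule.on (cohomology n).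

Definition cohomology_class n (f : cocycle n) : cohomology n :=
  \pi_(Quotient.quot (coboundary n))%qT f.

End Cohomology.

Section Extensions.
Variables (R : rcfType) (M : expansion R).
Variables (H : definableGroupType M) (N : definableZmodType M).
Variable gamma : definable_action H N.

Record extension := Extension {
  ext_group : definableGroupType M;
  ext_in : N -> ext_group;
  ext_out : ext_group -> H;
  ext_in_definable : definable_map ext_in;
  ext_out_definable : definable_map ext_out;
  ext_inD : {morph ext_in : a b / a + b >-> (a * b)%g};
  ext_outM : {morph ext_out : u v / (u * v)%g};
  ext_in_inj : injective ext_in;
  ext_out_surj : forall h, exists u, ext_out u = h;
  ext_exact : forall u, ext_out u = 1%g <-> exists a, ext_in a = u;
  ext_act : forall u a,
    ext_in (gamma (ext_out u) a) = (u * ext_in a * u^-1)%g }.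

Arguments ext_in : clear implicits.
Arguments ext_out : clear implicits.

Definition ext_equiv (E F : extension) : Prop :=
  exists phi : ext_group E -> ext_group F,
    [/\ definable_map phi, bijective phi, {morph phi : u v / (u * v)%g},
        forall a, phi (ext_in E a) = ext_in F a
      & forall u, ext_out F (phi u) = ext_out E u].

Definition ext_class (E : extension) : set extension := [set F | ext_equiv E F].

Definition lex (ltH : H -> H -> Prop) (ltN : N -> N -> Prop) (x y : N * H) :
    Prop :=
  ltH x.2 y.2 \/ x.2 = y.2 /\ ltN x.1 y.1.

(* The lexicographic order on an extension, without a choice of a bijection with
   N x H: elements u, v of the same coset of N are written u = b w and v = d w
   for a representative w of the coset, and compared by their coordinates b, d.
   As ltN is invariant under translations, w is immaterial: every section s of
   ext_out gives, through the bijection (b, h) |-> b s(h), the same order. *)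
Definition ext_lex (E : extension) (ltH : H -> H -> Prop) (ltN : N -> N -> Prop)
    (u v : ext_group E) : Prop :=
  ltH (ext_out E u) (ext_out E v) \/
  exists w b d,
    [/\ u = (ext_in E b * w)%g, v = (ext_in E d * w)%g & ltN b d].

Definition lex_ordered_extension (ltH : H -> H -> Prop) (ltN : N -> N -> Prop) :
    set extension :=
  [set E | ordered_group (@ext_lex E ltH ltN)].

Definition twisted_product (c : cocycle gamma 2) : Type := (N * H)%type.

Section CocycleExtension.
Variable c : cocycle gamma 2.

Definition cocycle_at (g h : H) : N := c [tuple g; h].

Lemma cocycleE g h k :
  gamma g (cocycle_at h k) + cocycle_at g (h * k)%g =
  cocycle_at (g * h)%g k + cocycle_at g h.
Proof.
have E n (s t : n.-tuple H) : (forall i, tnth s i = tnth t i) -> s = t.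
  exact: eq_from_tnth.
have := congr1 (fun f : cochain H N 3 => f [tuple g; h; k]) (delta_cocycle c).
rewrite /= -[RHS]/(0 : N) /delta_fun big_ord_recl big_ord1.
have -> : drop_first [tuple g; h; k] = [tuple h; k].
  by apply: E => -[[|[|//]] i]; rewrite tnth_mktuple !(tnth_nth 1%g).
have -> : drop_last [tuple g; h; k] = [tuple g; h].
  by apply: E => -[[|[|//]] i]; rewrite tnth_mktuple !(tnth_nth 1%g).
have -> : contract ord0 [tuple g; h; k] = [tuple (g * h)%g; k].
  by apply: E => -[[|[|//]] i]; rewrite tnth_mktuple !(tnth_nth 1%g).
have -> : contract (lift ord0 ord0) [tuple g; h; k] = [tuple g; (h * k)%g].
  by apply: E => -[[|[|//]] i]; rewrite tnth_mktuple !(tnth_nth 1%g).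
have -> : (-1 : int) ^+ 3 = -1 by [].
rewrite (tnth_nth 1%g) /= -!/(cocycle_at _ _).
rewrite (_ : (-1 : int) ^+ (bump 0 0).+1 = 1) // expr1 !mulrN1z mulr1z.
move/eqP; rewrite addrA subr_eq0 addrAC subr_eq => /eqP ->.
by rewrite addrC.
Qed.

Lemma dact1 a : gamma 1%g a = a.
Proof.
apply: (bij_inj (daut_bij (gamma 1%g))).
by rewrite -dactM mulg1.
Qed.

Lemma cocycle1g g : cocycle_at 1%g g = cocycle_at 1%g 1%g.
Proof.
by have := cocycleE 1%g 1%g g; rewrite dact1 !mul1g => /addrI.
Qed.

Lemma cocycleg1 g : cocycle_at g 1%g = gamma g (cocycle_at 1%g 1%g).
Proof.
by have := cocycleE g 1%g 1%g; rewrite !mulg1 => /addIr.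
Qed.

Definition twisted_mul (x y : twisted_product c) : twisted_product c :=
  (x.1 + gamma x.2 y.1 + cocycle_at x.2 y.2, (x.2 * y.2)%g).

Definition twisted_one : twisted_product c := (- cocycle_at 1%g 1%g, 1%g).

Definition twisted_inv (x : twisted_product c) : twisted_product c :=
  (- cocycle_at 1%g 1%g - cocycle_at x.2^-1%g x.2 - gamma x.2^-1%g x.1, x.2^-1%g).

Lemma twisted_mulA : associative twisted_mul.
Proof.
move=> [a g] [b h] [d k]; congr pair; rewrite /= ?mulgA // dactM !raddfD /=.
rewrite -!addrA; congr (_ + (_ + _)).
rewrite cocycleE [RHS]addrCA; congr (_ + _).
by rewrite addrC.
Qed.

Lemma twisted_mul1x : left_id twisted_one twisted_mul.
Proof.
move=> [a g]; congr pair; rewrite /= ?mul1g // dact1 (cocycle1g g).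
by rewrite addrAC addNr add0r.
Qed.

Lemma twisted_mulx1 : right_id twisted_one twisted_mul.
Proof.
by move=> [a g]; congr pair; rewrite /= ?mulg1 // raddfN /= (cocycleg1 g) addrNK.
Qed.

Lemma twisted_mulVx : left_inverse twisted_one twisted_inv twisted_mul.
Proof.
move=> [a g]; congr pair; rewrite /= ?mulVg //.
by rewrite addrNK addrNK.
Qed.

Lemma twisted_mulxV : right_inverse twisted_one twisted_inv twisted_mul.
Proof.
move=> [a g]; congr pair; rewrite /= ?mulgV // !raddfB raddfN /=.
rewrite -dactM mulgV dact1 [a + _]addrC addrNK.
have := cocycleE g g^-1%g g; rewrite mulVg mulgV (cocycle1g g) (cocycleg1 g) => e.
rewrite -opprD [_ + gamma g (cocycle_at g^-1%g g)]addrC e.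
by rewrite opprD addrNK.
Qed.

HB.instance Definition _ := Choice.copy (twisted_product c) (N * H)%type.
HB.instance Definition _ := isDefinable.Build R M (twisted_product c)
  (@prod_demb_inj R M N H) (prod_definable_range N H).
HB.instance Definition _ := isGroup.Build (twisted_product c)
  twisted_mulA twisted_mul1x twisted_mulx1 twisted_mulVx twisted_mulxV.

Lemma twisted_mul_definable :
  definable_map (fun p : twisted_product c * twisted_product c => (p.1 * p.2)%g).
Proof.
pose P := (twisted_product c * twisted_product c)%type.
have d11 : definable_map (fun p : P => p.1.1).
  exact: (definable_comp (@definable_fst _ _ N H) (@definable_fst _ _ _ _)).
have d12 : definable_map (fun p : P => p.1.2).
  exact: (definable_comp (@definable_snd _ _ N H) (@definable_fst _ _ _ _)).
have d21 : definable_map (fun p : P => p.2.1).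
  exact: (definable_comp (@definable_fst _ _ N H) (@definable_snd _ _ _ _)).
have d22 : definable_map (fun p : P => p.2.2).
  exact: (definable_comp (@definable_snd _ _ N H) (@definable_snd _ _ _ _)).
apply: (@definable_pair _ _ _ N H).
  apply: definable_map_add; first apply: definable_map_add => //.
    exact: (definable_comp (dact_definable gamma) (definable_pair d12 d21)).
  apply: (definable_comp (cochain_definable c)).
  have -> : (fun p : P => [tuple p.1.2; p.2.2]) =
      (fun p : P => [tuple tnth [tuple p.1.2; p.2.2] i | i < 2]).
    by apply/funext => p; apply/eq_from_tnth => i; rewrite tnth_mktuple.
  apply: definable_mktuple => -[[|[|//]] i].
    by under eq_fun do rewrite (tnth_nth 1%g).
  by under eq_fun do rewrite (tnth_nth 1%g).
exact: (definable_comp (@definable_mulg _ _ H) (definable_pair d12 d22)).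
Qed.

HB.instance Definition _ :=
  Group_isDefinableGroup.Build R M (twisted_product c) twisted_mul_definable.

(* The neutral element is (- c(1, 1), 1) as c is not assumed to be normalized. *)
Definition twisted_in (a : N) : twisted_product c := (a - cocycle_at 1%g 1%g, 1%g).

Definition twisted_out (x : twisted_product c) : H := x.2.

Lemma twisted_in_definable : definable_map twisted_in.
Proof.
apply: (@definable_pair _ _ _ N H); last exact: definable_cst.
apply: definable_map_add; first exact: definable_id.
exact: definable_cst.
Qed.

Lemma twisted_out_definable : definable_map twisted_out.
Proof. exact: (@definable_snd _ _ N H). Qed.

Lemma twisted_inD : {morph twisted_in : a b / a + b >-> (a * b)%g}.
Proof.
move=> a b; congr pair; rewrite /= ?mulg1 //.
by rewrite dact1 -[RHS]addrA addrNK [RHS]addrAC.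
Qed.

Lemma twisted_outM : {morph twisted_out : u v / (u * v)%g}.
Proof. by []. Qed.

Lemma twisted_in_inj : injective twisted_in.
Proof. by move=> a b [/addIr]. Qed.

Lemma twisted_out_surj h : exists u, twisted_out u = h.
Proof. by exists (0, h). Qed.

Lemma twisted_exact u : twisted_out u = 1%g <-> exists a, twisted_in a = u.
Proof.
case: u => b g; split=> [/= e|[a [_ <-]] //]; rewrite /twisted_out /= in e.
by exists (b + cocycle_at 1%g 1%g); rewrite /twisted_in addrK e.
Qed.

Lemma twisted_act u a :
  twisted_in (gamma (twisted_out u) a) = (u * twisted_in a * u^-1)%g.
Proof.
apply: (@mulIg _ u); rewrite mulgVK; case: u => b g; congr pair.
  rewrite /= dact1 (cocycle1g g) (cocycleg1 g) raddfB /=.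
  by rewrite [in RHS]addrA [RHS]addrNK addrAC addrNK addrC.
by rewrite /= mul1g mulg1.
Qed.

Definition cocycle_extension : extension :=
  Extension twisted_in_definable twisted_out_definable twisted_inD twisted_outM
    twisted_in_inj twisted_out_surj twisted_exact twisted_act.

Lemma cocycle_extension_lex ltH ltN (u v : twisted_product c) :
  ordered_zmodule ltN ->
  @ext_lex cocycle_extension ltH ltN u v <-> lex ltH ltN u v.
Proof.
move=> oN; have inM b (w : twisted_product c) :
    (twisted_in b * w)%g = (b + w.1, w.2) :> twisted_product c.
  by congr pair; rewrite /= ?mul1g // dact1 (cocycle1g w.2) addrAC addrNK.
rewrite /ext_lex /lex /=; split=> -[lt|]; try by left.
  move=> [w [b [d [-> -> lt]]]]; right; rewrite !inM; split=> //=.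
  exact: (order_mulr oN).
case: u v => [b g] [d h] /= [<- lt]; right.
by exists (0, g), b, d; rewrite !inM /= !addr0.
Qed.

End CocycleExtension.
End Extensions.

Arguments lex_ordered_extension {R M H N} gamma ltH ltN.
Arguments twisted_product {R M H N gamma} c.

(* Main.v *)
Require Import Defs.
From mathcomp Require Import all_boot all_order all_algebra all_classical.
From mathcomp Require Import ring_quotient lra.

(* An extension E is equivalent to the twisted product of a 2-cocycle c exactly
   when c is the factor set of a definable section s of E -> H, that is,
   s(g) s(h) = c(g, h) s(gh).  A definable section exists by definable choice, so
   every extension has a factor set; and the factor sets of the twisted product of
   d are the cocycles cohomologous to d, a section h |-> (f(h), h) having factor set
   d + delta f.  As gamma preserves the order of N, every twisted product is
   ordered lexicographically.

   Definable choice in one variable: the boundary B of a set X that is a finite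
   union of intervals is finite, and a nonempty X meets the finite set consisting
   of 0, of the points of B and b + 1, b - 1, (b + c) / 2 for b, c in B.  The least
   point of X in this set depends definably on X. *)

Set Implicit Arguments.
Unset Strict Implicit.
Unset Printing Implicit Defensive.
Import Order.TTheory GRing.Theory Num.Theory.

Local Open Scope classical_set_scope.
Local Open Scope ring_scope.

(** * Choosing a point in a finite union of intervals *)

Section OneVariable.
Variable R : rcfType.
Implicit Types (X : set R) (x y : R).

(** The frontier of [X] in the order topology, in a form that is first order in [X]. *)
Definition boundary X : set R := [set b | forall l u, l < b -> b < u ->
  (exists x, [/\ l < x, x < u & X x]) /\ (exists x, [/\ l < x, x < u & ~ X x])].

(** The point [b - 1] and the midpoint of [b] and [c] are given by equations between terms of the
    language, free of division. *)
Definition marked X : set R := [set x | [\/ x = 0, boundary X x,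
  exists b, boundary X b /\ (x = b + 1 \/ x + 1 = b) |
  exists b c, boundary X b /\ (boundary X c /\ x + x = b + c)]].

Definition chosen X : set R :=
  [set x | [/\ X x, marked X x & forall y, X y -> marked X y -> ~ y < x]].

Definition interval_bounds (I : interval R) : seq R :=
  let: Interval l r := I in
  (if l is BSide _ x then [:: x] else [::]) ++ (if r is BSide _ x then [:: x] else [::]).

Lemma interval_mono (I : interval R) x y :
  ~~ has (fun e => x <= e <= y) (interval_bounds I) ->
  x <= y -> (x \in I) = (y \in I).
Proof.
case: I => -[[] l|[]] [[] r|[]] /= h xy; rewrite !in_itv /= ?andbT ?andbF //;
  move: h; rewrite ?orbF ?negb_or; lra.
Qed.

(* Satisfied by a finite union [X] of intervals, with [E] the list of their
   endpoints. *)
Definition tame X (E : seq R) : Prop := forall x y, x <= y ->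
  ~~ has (fun e => x <= e <= y) E -> (X x <-> X y).

Lemma tame_intervals (s : seq (interval R)) :
  exists E, tame [set x | has (fun I => x \in I) s] E.
Proof.
exists (flatten [seq interval_bounds J | J <- s]) => x y xy h /=.
suff -> : has (fun I => x \in I) s = has (fun I => y \in I) s by [].
elim: s h => //= I s IH; rewrite has_cat negb_or => /andP[hI hs].
by rewrite IH // (interval_mono hI xy).
Qed.

(** A relation is left open so that [<=] yields least elements and [>=] greatest ones. *)
Lemma ex_extremal (le : rel R) (s : seq R) (P : set R) :
  total le -> transitive le -> (exists2 x, x \in s & P x) ->
  exists x, P x /\ forall y, y \in s -> P y -> le x y.
Proof.
move=> tot tr; elim: s => [[x]//|a s IH] [x xs Px].
have [[z zs Pz]|none] := pselect (exists2 z, z \in s & P z); last first.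
  have xa : x = a by move: xs; rewrite inE => /orP[/eqP //|xs]; case: none; exists x.
  subst a; exists x; split=> // y; rewrite inE => /orP[/eqP -> _|ys Py].
    by case/orP: (tot x x).
  by case: none; exists y.
have [m [Pm mle]] : exists x, P x /\ forall y, y \in s -> P y -> le x y.
  by apply: IH; exists z.
have [[Pa am]|h] := pselect (P a /\ le a m).
  exists a; split=> // y; rewrite inE => /orP[/eqP -> _|ys Py].
    by case/orP: (tot a a).
  exact: tr am (mle _ ys Py).
exists m; split=> // y; rewrite inE => /orP[/eqP -> Pa|]; last exact: mle.
by case/orP: (tot m a) => // am; case: h.
Qed.

(** Each point of [E] other than [p] pulls one end of the interval in to itself, if it is not
    already outside. *)
Lemma punctured_gap (E : seq R) p : exists l u, [/\ l < p, p < u &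
  forall e, e \in E -> l < e -> e < u -> e = p].
Proof.
elim: E => [|a E [l [u [lp pu h]]]]; first by exists (p - 1), (p + 1); split=> //; lra.
case: (ltrgtP a p) => ap.
- exists (Num.max l a), u; rewrite gt_max lp ap; split=> // e; rewrite inE gt_max.
  by move=> /orP[/eqP ->|eE /andP[? _]]; [rewrite ltxx andbF | exact: h].
- exists l, (Num.min u a); rewrite lt_min pu ap; split=> // e; rewrite inE lt_min.
  by move=> /orP[/eqP ->|eE ? /andP[? _]]; [rewrite ltxx andbF | exact: h].
- exists l, u; split=> // e; rewrite inE => /orP[/eqP -> //|]; exact: h.
Qed.

(** Around a point outside [E] there is a gap without points of [E], on which [X] is constant. *)
Lemma tame_boundary X E b : tame X E -> boundary X b -> b \in E.
Proof.
move=> tX bX; apply/negPn/negP => bE.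
have [l [u [lb bu h]]] := punctured_gap E b.
have [[x [lx xu Xx]] [y [ly yu Xy]]] := bX l u lb bu.
have key v w : l < v -> w < u -> v <= w -> (X v <-> X w).
  move=> lv wu vw; apply: tX => //; apply/hasPn => e eE; apply/negP => /andP[ve ew].
  by move/negP: bE; rewrite -(h e eE) //;
    [exact: lt_le_trans lv ve | exact: le_lt_trans ew wu].
by case: (leP x y) => [xy|/ltW xy]; have := key _ _ _ _ xy; tauto.
Qed.

(** As [R] may lack suprema, the boundary point is found by induction on the number of endpoints in
    [[x, y]]. An endpoint [e] that is not a boundary point is cut off together with one side of it,
    keeping a shorter interval at whose ends [X] still differs. *)
Lemma boundary_between X E x y : tame X E -> x <= y -> ~ (X x <-> X y) ->
  exists b, [/\ x <= b, b <= y & boundary X b].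
Proof.
move=> tX; have [n] := ubnP (count (fun e => x <= e <= y) E).
elim: n x y => // n IH x y; rewrite ltnS => cn xy Xxy.
have /hasP[e eE /andP[xe ey]] : has (fun e => x <= e <= y) E.
  by apply/negPn/negP => /(tX _ _ xy).
have [bXe|] := pselect (boundary X e); first by exists e.
move/existsNP => -[l] /existsNP[u] /not_implyP[le] /not_implyP[eu] nb.
have const v : l < v -> v < u -> (X v <-> X e).
  move=> lv vu; have [Xe|Xe] := pselect (X e); split=> // Xv.
    by apply: contrapT => Xv'; apply: nb; split; [exists e | exists v].
  by exfalso; apply: nb; split; [exists v | exists e].
(* A subinterval that misses [e] has fewer endpoints: those of [[x, y]] split into the ones in
   [[v, w]] and the others, among which is [e]. *)
have smaller v w : x <= v -> w <= y -> (e < v) || (w < e) ->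
    (count (fun e => (v <= e <= w)%R) E < n)%N.
  move=> xv wy evw; apply: leq_trans cn.
  rewrite -(size_filter (fun e => (v <= e <= w)%R)) -size_filter.
  have -> : [seq a <- E | (v <= a <= w)%R] =
      [seq a <- [seq a <- E | (x <= a <= y)%R] | (v <= a <= w)%R].
    rewrite -filter_predI; apply: eq_filter => a /=; lra.
  rewrite size_filter -[X in (_ < X)%N](count_predC (fun a => (v <= a <= w)%R)).
  rewrite -[X in (X < _)%N]addn0 ltn_add2l -has_count; apply/hasP; exists e.
    by rewrite mem_filter xe ey.
  by rewrite /=; lra.
(* Since [X] differs at [x] and [y], its value at [e] differs from one of them. The interval kept
   lies on that side and ends inside [(l, u)], where [X] has its value at [e]. *)
have [Xey|Xey] := pselect (X e <-> X y).
  have xl : x <= l.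
    by rewrite leNgt; apply/negP => lx; apply: Xxy; rewrite const //; lra.
  have [|||b [? ? ?]] := IH x ((l + e) / 2).
  - by apply: smaller; lra.
  - by lra.
  - by rewrite (const ((l + e) / 2)) ?Xey //; lra.
  by exists b; split=> //; lra.
have uy : u <= y.
  by rewrite leNgt; apply/negP => yu; apply: Xey; rewrite const //; lra.
have [|||b [? ? ?]] := IH ((e + u) / 2) y.
- by apply: smaller; lra.
- by lra.
- by rewrite (const ((e + u) / 2)) //; lra.
by exists b; split=> //; lra.
Qed.

Lemma marked_in_seq X E : tame X E ->
  exists s : seq R, forall x, marked X x -> x \in s.
Proof.
move=> tX; have bE b : boundary X b -> b \in E by exact: tame_boundary.
exists (0 :: E ++ [seq b + 1 | b <- E] ++ [seq b - 1 | b <- E] ++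
  [seq (b + c) / 2 | b <- E, c <- E]) => x.
rewrite inE !mem_cat => -[->|/bE ->|[b [/bE bb [->|xb]]]|[b [c [/bE bb [/bE cc xx]]]]].
- by rewrite eqxx.
- by rewrite orbT.
- by rewrite (map_f (fun b => b + 1)) // !orbT.
- have -> : x = b - 1 by lra.
  by rewrite (map_f (fun b => b - 1)) // !orbT.
- have -> : x = (b + c) / 2 by lra.
  by rewrite (allpairs_f (fun b c => (b + c) / 2)) // !orbT.
Qed.

(** Let [b1] be the greatest boundary point below or at [x] and [b2] the least one above or at [x].
    The witness is 0, [b2 - 1], [b1 + 1] or the midpoint of [b1] and [b2], according to which of
    them exist; no boundary point separates it from [x]. *)
Lemma marked_meets X E : tame X E -> (exists x, X x) ->
  exists x, X x /\ marked X x.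
Proof.
move=> tX [x Xx].
have stay m : (forall b, boundary X b -> ~ (m <= b <= x) /\ ~ (x <= b <= m)) -> X m.
  move=> h; apply: contrapT => Xm.
  have [mx|/ltW xm] := leP m x.
    have [|b [mb bx /h[]]] := boundary_between tX mx; first tauto.
    by rewrite mb bx.
  have [|b [mb bx /h[]]] := boundary_between tX xm; first tauto.
  by rewrite mb bx.
have extr (rl : rel R) : total rl -> transitive rl ->
    (forall b, boundary X b -> ~ rl x b) \/
    exists b, [/\ boundary X b, rl x b & forall c, boundary X c -> rl x c -> rl b c].
  move=> tot tr; have [[b bb xb]|h] := pselect (exists2 b, boundary X b & rl x b).
    right; have [|c [[bc xc] ch]] :=
      @ex_extremal rl E [set b | boundary X b /\ rl x b] tot tr.
      by exists b => //; exact: tame_boundary bb.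
    exists c; split=> // d bd xd; apply: ch => //; exact: tame_boundary bd.
  by left=> b bb xb; apply: h; exists b.
have := extr <=%R le_total le_trans.
have := extr >=%R ge_total ge_trans.
case=> [nl|[b1 [bb1 /= xb1 h1]]] [nu|[b2 [bb2 /= xb2 h2]]].
- exists 0; split; last by constructor 1.
  by apply: stay => b bb; have /negP := nl _ bb; have /negP := nu _ bb; rewrite /=; lra.
- exists (b2 - 1); split; last by constructor 3; exists b2; split=> //; right; lra.
  apply: stay => b bb; have /negP := nl _ bb; have := h2 _ bb; rewrite /=.
  by case: (leP x b) => [_ /(_ isT)|_ _]; lra.
- exists (b1 + 1); split; last by constructor 3; exists b1; split=> //; left.
  apply: stay => b bb; have /negP := nu _ bb; have := h1 _ bb; rewrite /=.
  by case: (leP b x) => [_ /(_ isT)|_ _]; lra.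
(* The case of equality includes that of a boundary point [x], where [b1] and [b2] are both [x].
   Otherwise [b1 < b2]. *)
have [e|e] := eqVneq x ((b1 + b2) / 2).
  by exists x; split=> //; constructor 4; exists b1, b2; do 2 split=> //; lra.
exists ((b1 + b2) / 2); split; last by constructor 4; exists b1, b2;
  do 2 split=> //; lra.
apply: stay => b bb; have := h1 _ bb; have := h2 _ bb; rewrite /= => H2 H1.
split=> /andP[p q].
  by have := H1 q; move/eqP: e; lra.
by have := H2 p; move/eqP: e; lra.
Qed.

Lemma chosen_sub X x : chosen X x -> X x.
Proof. by case. Qed.

Lemma chosen_unique X x y : chosen X x -> chosen X y -> x = y.
Proof.
case=> Xx mx hx [Xy my hy]; have := hx _ Xy my; have := hy _ Xx mx.
by case: (ltrgtP x y).
Qed.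

Lemma chosen_exists X E : tame X E -> (exists x, X x) -> exists x, chosen X x.
Proof.
move=> tX /(marked_meets tX)[x [Xx mx]]; have [s sP] := marked_in_seq tX.
have [|m [[Xm mm] h]] :=
  @ex_extremal <=%R s [set x | X x /\ marked X x] le_total le_trans.
  by exists x => //; exact: sP.
exists m; split=> // y Xy my; apply/negP; rewrite -leNgt; apply: h => //; exact: sP.
Qed.

End OneVariable.

(** * Definable choice *)

Section Instantiation.
Variables (R : rcfType) (M : expansion R).

(* o-minimality speaks of one-variable formulas with parameters, so the other
   variables of a formula have to be replaced by constants: [p i = Some a]
   substitutes [a] for the variable [i]. *)
Fixpoint tinst (p : nat -> option R) (t : term M) : term M :=
  match t with
  | Var i => if p i is Some a then Cst M a else Var M i
  | Cst a => Cst M a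
  | Add t u => Add (tinst p t) (tinst p u)
  | Opp t => Opp (tinst p t)
  | Mul t u => Mul (tinst p t) (tinst p u)
  | App f ts => App (fun i => tinst p (ts i))
  end.

Definition pup (p : nat -> option R) (i : nat) : option R :=
  if i is j.+1 then p j else None.

Fixpoint finst (p : nat -> option R) (phi : formula M) : formula M :=
  match phi with
  | Eq t u => Eq (tinst p t) (tinst p u)
  | Lt t u => Lt (tinst p t) (tinst p u)
  | Rel r ts => Rel (fun i => tinst p (ts i))
  | Not phi => Not (finst p phi)
  | And phi psi => And (finst p phi) (finst p psi)
  | Ex phi => Ex (finst (pup p) phi)
  end.

Lemma eval_inst e p t : eval e (tinst p t) = eval (fun i => odflt (e i) (p i)) t.
Proof.
elim: t => //= [i | t -> u -> | t -> | t -> u -> | f ts IH] //; first by case: (p i).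
by congr finterp; apply/funext => i; rewrite IH.
Qed.

Lemma sat_inst phi p e :
  sat e (finst p phi) <-> sat (fun i => odflt (e i) (p i)) phi.
Proof.
elim: phi p e => /= [t u|t u|r ts|phi IH|phi IH psi IH'|phi IH] p e.
- by rewrite !eval_inst.
- by rewrite !eval_inst.
- by under eq_fun do rewrite eval_inst.
- by rewrite IH.
- by rewrite IH IH'.
suff E a : (fun i => odflt (scons a e i) (pup p i)) =
    scons a (fun i => odflt (e i) (p i)).
  by split=> -[a]; [rewrite IH E | rewrite -E -IH]; exists a.
by apply/funext => -[].
Qed.

Lemma o_minimal_tame (phi : formula M) (e : nat -> R) : o_minimal M ->
  exists E, tame [set a | sat (scons a e) phi] E.
Proof.
move=> omin; have [|s sP] := omin [set x | sat (scons (x 0 0) e) phi].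
  (* Only the variable 0 remains; the variable [j.+1] becomes the constant [e j]. *)
  exists (finst (fun i => if i is j.+1 then Some (e j) else None) phi) => x /=.
  rewrite sat_inst; suff -> : (fun i => odflt (env x i)
      (if i is j.+1 then Some (e j) else None)) = scons (x 0 0) e by [].
  by apply/funext => -[|i] //=; rewrite (env_ord x ord0).
have [E tE] := tame_intervals s; exists E.
suff -> : [set a | sat (scons a e) phi] = [set a | has (fun J => a \in J) s] by [].
apply/seteqP; split=> a /= h.
  have : [set x : 'rV_1 | sat (scons (x 0 0) e) phi] a%:M by rewrite /= mxE.
  by rewrite sP /= mxE.
have : [set x : 'rV_1 | has (fun J => x 0 0 \in J) s] a%:M by rewrite /= mxE.
by rewrite -sP /= mxE.
Qed.

End Instantiation.

(** * Formulas for the chosen point, and choice in several variables *)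

Section Choice.
Variables (R : rcfType) (M : expansion R).
Implicit Types (P Q : (nat -> R) -> Prop) (A : R -> (nat -> R) -> Prop).

(** Predicates on environments stand in for formulas, so that definability follows from closure
    under connectives and quantifiers. *)
Definition expressible P : Prop :=
  exists phi : formula M, forall e, sat e phi <-> P e.

(* The point is the variable 0 and the parameters are the remaining ones. *)
Definition expressible_family A : Prop :=
  expressible (fun e => A (e 0%N) (fun i => e i.+1)).

Lemma expressible_not P : expressible P -> expressible (fun e => ~ P e).
Proof. by case=> phi E; exists (Not phi) => e /=; rewrite E. Qed.

Lemma expressible_and P Q :
  expressible P -> expressible Q -> expressible (fun e => P e /\ Q e).
Proof.
by case=> phi E [psi F]; exists (And phi psi) => e /=; rewrite E F.
Qed.

Lemma expressible_ex A :
  expressible_family A -> expressible (fun e => exists a, A a e).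
Proof.
by case=> phi E; exists (Ex phi) => e /=; split=> -[a] => [/E|/(E (scons a e))] h;
  exists a.
Qed.

Lemma expressible_iff P Q :
  (forall e, P e <-> Q e) -> expressible P -> expressible Q.
Proof. by move=> h [phi E]; exists phi => e; rewrite E. Qed.

Lemma expressible_or P Q :
  expressible P -> expressible Q -> expressible (fun e => P e \/ Q e).
Proof.
move=> dP dQ; apply: (@expressible_iff (fun e => ~ (~ P e /\ ~ Q e))).
  by move=> e; have := EM (P e); have := EM (Q e); tauto.
by apply: expressible_not; apply: expressible_and; exact: expressible_not.
Qed.

Lemma expressible_imply P Q :
  expressible P -> expressible Q -> expressible (fun e => P e -> Q e).
Proof.
move=> dP dQ; apply: (@expressible_iff (fun e => ~ P e \/ Q e)).
  by move=> e; have := EM (P e); tauto.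
by apply: expressible_or => //; exact: expressible_not.
Qed.

Lemma expressible_all A :
  expressible_family A -> expressible (fun e => forall a, A a e).
Proof.
move=> dA; apply: (@expressible_iff (fun e => ~ exists a, ~ A a e)).
  move=> e; split=> [h a|h [a]]; last by apply.
  by apply: contrapT => na; apply: h; exists a.
by apply: expressible_not; apply: expressible_ex; exact: expressible_not.
Qed.

Lemma expressible_eq (t u : term M) : expressible (fun e => eval e t = eval e u).
Proof. by exists (Eq t u). Qed.

Lemma expressible_lt (t u : term M) : expressible (fun e => eval e t < eval e u).
Proof. by exists (Lt t u). Qed.

(** Used under quantifiers: [k] is the index of the point, and the parameters start at the index
    [m]. *)
Lemma expressible_at A k m : expressible_family A ->
  expressible (fun e => A (e k) (fun i => e (m + i)%N)).
Proof.
case=> phi E; exists (fren (fun i => if i is j.+1 then (m + j)%N else k) phi) => e.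
by rewrite sat_ren E.
Qed.

Lemma boundary_expressible A : expressible_family A ->
  expressible_family (fun b e => boundary (A^~ e) b).
Proof.
move=> dA; apply: (@expressible_iff (fun e => forall l u, l < e 0%N -> e 0%N < u ->
    (exists x, l < x /\ (x < u /\ A x (fun i => e i.+1))) /\
    (exists x, l < x /\ (x < u /\ ~ A x (fun i => e i.+1))))).
  move=> e; split=> h l u lb bu; have [[x hx] [y hy]] := h l u lb bu; split.
  - by exists x; case: hx => ? [].
  - by exists y; case: hy => ? [].
  - by exists x; case: hx.
  - by exists y; case: hy.
(* Under all the quantifiers the variables [x], [u], [l], [b] have the indices 0 to 3, and the
   parameters start at 4. *)
apply: expressible_all; apply: expressible_all; apply: expressible_imply.
  exact: (expressible_lt (Var M 1) (Var M 2)).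
apply: expressible_imply; first exact: (expressible_lt (Var M 2) (Var M 0)).
apply: expressible_and; apply: expressible_ex; (apply: expressible_and;
  [exact: (expressible_lt (Var M 2) (Var M 0)) | apply: expressible_and;
  [exact: (expressible_lt (Var M 0) (Var M 1)) | ]]).
  exact: (@expressible_at A 0 4).
apply: expressible_not; exact: (@expressible_at A 0 4).
Qed.

Lemma marked_expressible A : expressible_family A ->
  expressible_family (fun x e => marked (A^~ e) x).
Proof.
move=> /boundary_expressible dB; set B := fun b e => boundary _ b in dB.
apply: (@expressible_iff (fun e => e 0%N = 0 \/ (B (e 0%N) (fun i => e i.+1) \/
   ((exists b, B b (fun i => e i.+1) /\ (e 0%N = b + 1 \/ e 0%N + 1 = b)) \/
    (exists b c, B b (fun i => e i.+1) /\
      (B c (fun i => e i.+1) /\ e 0%N + e 0%N = b + c)))))).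
  move=> e; split; last by case; intuition.
  by case=> [|[|[|]]] h; [constructor 1|constructor 2|constructor 3|constructor 4].
apply: expressible_or; first exact: (expressible_eq (Var M 0) (Cst M 0)).
apply: expressible_or; first exact: (@expressible_at B 0 1).
apply: expressible_or; apply: expressible_ex.
  apply: expressible_and; first exact: (@expressible_at B 0 2).
  apply: expressible_or; first
    exact: (expressible_eq (Var M 1) (Add (Var M 0) (Cst M 1))).
  exact: (expressible_eq (Add (Var M 1) (Cst M 1)) (Var M 0)).
apply: expressible_ex; apply: expressible_and; first exact: (@expressible_at B 1 3).
apply: expressible_and; first exact: (@expressible_at B 0 3).
exact: (expressible_eq (Add (Var M 2) (Var M 2)) (Add (Var M 1) (Var M 0))).
Qed.

Lemma chosen_expressible A : expressible_family A ->
  expressible_family (fun x e => chosen (A^~ e) x).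
Proof.
move=> dA; have dS := marked_expressible dA; set S := fun x e => marked _ x in dS.
apply: (@expressible_iff (fun e => A (e 0%N) (fun i => e i.+1) /\
   (S (e 0%N) (fun i => e i.+1) /\
    forall y, A y (fun i => e i.+1) -> S y (fun i => e i.+1) -> ~ y < e 0%N))).
  by move=> e; split=> [[? []]|[]].
apply: expressible_and => //; apply: expressible_and => //.
apply: expressible_all; apply: expressible_imply; first exact: (@expressible_at A 0 2).
apply: expressible_imply; first exact: (@expressible_at S 0 2).
apply: expressible_not; exact: (expressible_lt (Var M 0) (Var M 1)).
Qed.

Lemma scons_scat n a (y : 'rV[R]_n) e :
  scons a (scat y e) = scat (row_mx (a%:M : 'rV_1) y : 'rV_n.+1) e.
Proof.
apply/funext => -[|i] /=.
  by rewrite (scat_ord _ e (lshift n (ord0 : 'I_1))) row_mxEl mxE.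
case: (ltnP i n) => [lt|le]; last by rewrite !scat_ge // subSS.
rewrite -[i]/(val (Ordinal lt)) scat_ord.
by rewrite (scat_ord _ e (rshift 1 (Ordinal lt))) row_mxEr.
Qed.

Lemma scat_split n (y : 'rV[R]_n.+1) e : exists a (z : 'rV_n),
  y = row_mx (a%:M : 'rV_1) z /\ scat y e = scons a (scat z e).
Proof.
exists (lsubmx (y : 'rV_(1 + n)) 0 0), (rsubmx (y : 'rV_(1 + n))).
by rewrite scons_scat -mx11_scalar hsubmxK.
Qed.

(* The [n] variables to be chosen are the first ones; by induction the last [n] of
   [n + 1] are chosen first, and then the variable 0 in the fibre over them. *)
Lemma definable_choice n P : o_minimal M -> expressible P ->
  exists Q, [/\ expressible Q, forall e, Q e -> P e,
    forall e, (exists y : 'rV_n, P (scat y e)) -> exists y : 'rV_n, Q (scat y e)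
    & forall e (y z : 'rV_n), Q (scat y e) -> Q (scat z e) -> y = z].
Proof.
move=> omin; elim: n P => [|n IH] P dP.
  by exists P; split=> // e y z _ _; apply/rowP => -[].
pose A a e := P (scons a e).
have consE (e : nat -> R) : scons (e 0%N) (fun i => e i.+1) = e by apply/funext => -[].
have dA : expressible_family A.
  by apply: expressible_iff dP => e; rewrite /A consE.
have [Q [dQ QP exQ unQ]] := IH _ (expressible_ex dA).
have tA e : exists E, tame (A^~ e) E.
  case: dP => phi E; have [F tF] := o_minimal_tame phi e omin.
  exists F => x y xy h; have := tF x y xy h; rewrite /= !E; tauto.
exists (fun e => Q (fun i => e i.+1) /\ chosen (A^~ (fun i => e i.+1)) (e 0%N)); split.
- apply: expressible_and (chosen_expressible dA).
  by case: dQ => psi E; exists (fren S psi) => e; rewrite sat_ren E.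
- by move=> e [_ /chosen_sub]; rewrite /A consE.
- move=> e [y]; have [a [z [_ ->]]] := scat_split y e => Paz.
  have [|w Qw] := exQ e; first by exists z, a.
  have [E tE] := tA (scat w e); have [b cb] := chosen_exists tE (QP _ Qw).
  by exists (row_mx (b%:M : 'rV_1) w); rewrite -scons_scat.
move=> e y z; have [a [y' [-> ->]]] := scat_split y e.
have [b [z' [-> ->]]] := scat_split z e.
move=> [/= Qy cy] [Qz cz]; have eyz : y' = z' by exact: unQ Qy Qz.
by subst z'; rewrite (chosen_unique cy cz).
Qed.

End Choice.

Lemma env_row_mx (R : rcfType) m n (y : 'rV[R]_m) (x : 'rV[R]_n) :
  env (row_mx y x) = scat y (env x).
Proof.
apply/funext => i; case: (ltnP i m) => [lt|le].
  rewrite -[i]/(val (Ordinal lt)) scat_ord.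
  by rewrite (env_ord _ (lshift _ (Ordinal lt))) row_mxEl.
rewrite scat_ge //; case: (ltnP (i - m) n) => [lt|le'].
  have {1}-> : i = rshift m (Ordinal lt) by rewrite /= subnKC.
  by rewrite env_ord row_mxEr -[(i - _)%N]/(val (Ordinal lt)) env_ord.
by rewrite !env_ge // -(subnKC le) leq_add2l.
Qed.

Lemma coord_swap (R : rcfType) (M : expansion R) (T U : definableType M) :
  coord_map (fun p : T * U => (p.2, p.1)).
Proof. by apply: coord_pair; [exact: coord_snd | exact: coord_fst]. Qed.

(** In the graph of [f] the coordinates of [u] come first: they are the variables to be chosen, with
    the coordinates of [h] as parameters. As [Q] implies membership in the graph, the chosen vector
    encodes a point of the fibre over [h]. *)
Lemma definable_section (R : rcfType) (M : expansion R) (U H : definableType M)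
    (f : U -> H) : o_minimal M -> definable_map f -> (forall h, exists u, f u = h) ->
  exists2 s : H -> U, definable_map s & cancel s f.
Proof.
move=> omin [phi df] surj.
have envE (u : U) (h : H) := env_row_mx (demb u) (demb h).
have [|Q [[psi dQ] QP exQ unQ]] :=
  @definable_choice R M (ddim U) (fun e => sat e phi) omin.
  by exists phi.
have ex (h : H) : exists u : U, Q (scat (demb u) (env (demb h))).
  have [u uh] := surj h; have [|y Qy] := exQ (env (demb h)).
    by exists (demb u); rewrite -envE; apply/df; exists (u, h).
  have := QP _ Qy; rewrite -env_row_mx.
  by move=> /df[[u' h'] /= _ /eq_row_mx[/= yu _]]; exists u'; rewrite yu.
have [s sP] := choice ex.
exists s; last first.
  by move=> h; have := QP _ (sP h); rewrite -envE =>
    /df[[u h'] /= e /eq_row_mx[/= /demb_inj <- /demb_inj <-]].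
rewrite /definable_map.
(* Uniqueness in [Q] makes the graph of [s] the set that [Q] defines, with the two factors
   swapped. *)
have -> : [set p : H * U | s p.1 = p.2] =
    (fun p => (p.2, p.1)) @^-1` [set q : U * H | Q (env (demb q))].
  apply/seteqP; split=> -[h u] /=;
    rewrite [demb _]/(row_mx (demb u) (demb h)) envE; first by move=> <-.
  by move=> q; apply: demb_inj; exact: unQ (sP h) q.
apply: definable_set_preim_coord (coord_swap _ _) _.
rewrite /definable_set.
have -> : demb @` [set q : U * H | Q (env (demb q))] =
    range (@demb _ _ (U * H)%type) `&` [set x | Q (env x)].
  by apply/seteqP; split=> [x [q /= Qq <-]|x [[q _ <-] Qq]];
    [split=> //; exists q | exists q].
apply: definableI; first exact: definable_range.
by exists psi => x; rewrite /= dQ.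
Qed.

(** * Extensions and factor sets *)

Section DefinableMaps.
Variables (R : rcfType) (M : expansion R).
Implicit Types T U : definableType M.

Lemma definable_set_eq T U (f g : T -> U) : definable_map f -> definable_map g ->
  definable_set [set x | f x = g x].
Proof.
move=> df dg.
rewrite -[X in definable_set X]/((fun x => (f x, g x)) @^-1` [set p | p.1 = p.2]).
apply: (definable_set_preim (definable_pair df dg)).
by apply: definable_set_eq_coord; [exact: coord_fst | exact: coord_snd].
Qed.

Lemma definable_setU T (A B : set T) :
  definable_set A -> definable_set B -> definable_set (A `|` B).
Proof.
move=> dA dB; rewrite -[A `|` B]setCK setCU.
by apply: definable_setC; apply: definable_setI; exact: definable_setC.
Qed.

Lemma definable_map_inv T U (f : T -> U) (g : U -> T) :
  cancel f g -> cancel g f -> definable_map f -> definable_map g.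
Proof.
move=> fK gK df; rewrite /definable_map.
have -> : [set p : U * T | g p.1 = p.2] =
    (fun p => (p.2, p.1)) @^-1` [set p : T * U | f p.1 = p.2].
  by apply/seteqP; split=> -[u t] /= <-.
exact: definable_set_preim_coord (coord_swap _ _) df.
Qed.

End DefinableMaps.

Arguments ext_in {R M H N gamma} e _.
Arguments ext_out {R M H N gamma} e _.

Section Factor.
Variables (R : rcfType) (M : expansion R).
Variables (H : definableGroupType M) (N : definableZmodType M).
Variable gamma : definable_action H N.
Implicit Types (E F : extension gamma) (c d : cocycle gamma 2).

Lemma ext_equiv_refl E : ext_equiv E E.
Proof.
by exists id; split=> //; [exact: definable_id | exists id].
Qed.

Lemma ext_equiv_sym E F : ext_equiv E F -> ext_equiv F E.
Proof.
move=> [phi [dphi [psi phiK psiK] phiM phi_in phi_out]]; exists psi; split.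
- exact: definable_map_inv dphi.
- by exists phi.
- by move=> u v; apply: (can_inj phiK); rewrite phiM !psiK.
- by move=> a; rewrite -phi_in phiK.
- by move=> u; rewrite -phi_out psiK.
Qed.

Lemma ext_equiv_trans E F G : ext_equiv E F -> ext_equiv F G -> ext_equiv E G.
Proof.
move=> [phi [dphi bphi phiM phi_in phi_out]] [psi [dpsi bpsi psiM psi_in psi_out]].
exists (psi \o phi); split=> [|||a|u] /=.
- exact: definable_comp dpsi dphi.
- exact: bij_comp.
- by move=> u v /=; rewrite phiM psiM.
- by rewrite phi_in psi_in.
- by rewrite psi_out phi_out.
Qed.

Lemma ext_classP E F : ext_class E = ext_class F <-> ext_equiv E F.
Proof.
split=> [e|eEF].
  by rewrite -[ext_equiv E F]/(ext_class E F) e; exact: ext_equiv_refl.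
apply/seteqP; split=> G /= h; last exact: ext_equiv_trans eEF h.
exact: ext_equiv_trans (ext_equiv_sym eEF) h.
Qed.

Definition factor_set E (c : H -> H -> N) : Prop :=
  exists s : H -> ext_group E, [/\ definable_map s, cancel s (ext_out E) &
    forall g h, (s g * s h = ext_in E (c g h) * s (g * h))%g].

Lemma ext_out_in E a : ext_out E (ext_in E a) = 1%g.
Proof. by apply/ext_exact; exists a. Qed.

Lemma ext_comm E u a : (u * ext_in E a = ext_in E (gamma (ext_out E u) a) * u)%g.
Proof. by rewrite ext_act mulgVK. Qed.

Lemma ext_fiber E u v : ext_out E u = ext_out E v ->
  exists a, u = (ext_in E a * v)%g.
Proof.
move=> e; have [|a ea] := (ext_exact (u * v^-1)%g).1.
  by apply: (@mulIg _ (ext_out E v)); rewrite -ext_outM mulgVK mul1g.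
by exists a; rewrite ea mulgVK.
Qed.

(** The shift by [- c(1, 1)] in [twisted_in] cancels against [c(1, h)], which equals [c(1, 1)]. *)
Lemma twisted_pairE c (a : N) (h : H) :
  ((a, h) : twisted_product c) = (twisted_in c a * ((0, h) : twisted_product c))%g.
Proof.
by congr pair; rewrite /= ?mul1g // raddf0 addr0 (cocycle1g c h) addrNK.
Qed.

(** From a section [s], the equivalence is [(a, h) |-> a s(h)]. Conversely, an equivalence carries
    the section [h |-> (0, h)] of the twisted product, whose factor set is [c], to a section of
    [E]. *)
Lemma factor_setP E c :
  factor_set E (cocycle_at c) <-> ext_equiv (cocycle_extension c) E.
Proof.
split=> [[s [ds sK sM]]|[phi [dphi bphi phiM phi_in phi_out]]]; last first.
  exists (fun h => phi ((0, h) : twisted_product c)); split=> [|h|g h].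
  - apply: (definable_comp dphi (f := fun h => ((0, h) : twisted_product c))).
    exact: (@definable_pair _ _ _ N H _ _ (definable_cst _ _) (definable_id _)).
  - exact: phi_out.
  rewrite -phiM -phi_in -phiM; congr phi; rewrite -[RHS]twisted_pairE.
  by congr pair; rewrite /= raddf0 !add0r.
pose phi (x : twisted_product c) := (ext_in E x.1 * s x.2)%g.
have phi_out x : ext_out E (phi x) = x.2 by rewrite ext_outM ext_out_in mul1g sK.
exists phi; split=> //.
- apply: (definable_comp (@definable_mulg _ _ _) (f := fun x => (ext_in E x.1, s x.2))).
  apply: definable_pair.
    exact: (definable_comp (ext_in_definable E) (@definable_fst _ _ N H)).
  exact: (definable_comp ds (@definable_snd _ _ N H)).
- have /choice [psi psiP] : forall u, exists x : twisted_product c, phi x = u.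
    move=> u; have [|a ->] := @ext_fiber E u (s (ext_out E u)); first by rewrite sK.
    by exists ((a, ext_out E u) : twisted_product c).
  have phi_inj x y : phi x = phi y -> x = y.
    move=> e; have := congr1 (ext_out E) e; rewrite !phi_out => exy.
    move: e; rewrite /phi exy => /mulIg/ext_in_inj; move: exy.
    by case: x => a g; case: y => b h /= -> ->.
  by exists psi => // x; apply: phi_inj.
(* Moving [b] to the left past [s g] turns it into [gamma g b]. *)
- move=> [a g] [b h]; rewrite /phi /= !ext_inD -!mulgA -sM; congr (_ * _)%g.
  by rewrite !mulgA ext_comm sK.
move=> a; rewrite /phi /=.
(* The section need not be normalized: [s(1) s(1) = c(1, 1) s(1)] gives its value at 1, which undoes
   the shift in [twisted_in]. *)
have s1 : s 1%g = ext_in E (cocycle_at c 1%g 1%g).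
  by apply: (@mulIg _ (s 1%g)); rewrite sM mulg1.
by rewrite s1 -ext_inD addrNK.
Qed.

(** * Low-degree coboundaries, and factor sets as cocycles *)

Lemma delta2E (f : 2.-tuple H -> N) g h k : delta_fun gamma f [tuple g; h; k] =
  gamma g (f [tuple h; k]) - f [tuple (g * h)%g; k]
  + f [tuple g; (h * k)%g] - f [tuple g; h].
Proof.
have E n (s t : n.-tuple H) : (forall i, tnth s i = tnth t i) -> s = t.
  exact: eq_from_tnth.
rewrite /delta_fun big_ord_recl big_ord1.
have -> : drop_first [tuple g; h; k] = [tuple h; k].
  by apply: E => -[[|[|//]] i]; rewrite tnth_mktuple !(tnth_nth 1%g).
have -> : drop_last [tuple g; h; k] = [tuple g; h].
  by apply: E => -[[|[|//]] i]; rewrite tnth_mktuple !(tnth_nth 1%g).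
have -> : contract ord0 [tuple g; h; k] = [tuple (g * h)%g; k].
  by apply: E => -[[|[|//]] i]; rewrite tnth_mktuple !(tnth_nth 1%g).
have -> : contract (lift ord0 ord0) [tuple g; h; k] = [tuple g; (h * k)%g].
  by apply: E => -[[|[|//]] i]; rewrite tnth_mktuple !(tnth_nth 1%g).
have -> : (-1 : int) ^+ 3 = -1 by [].
by rewrite (tnth_nth 1%g) /= (_ : (-1 : int) ^+ (bump 0 0).+1 = 1) //
  expr1 !mulrN1z mulr1z addrA.
Qed.

Lemma delta1E (f : 1.-tuple H -> N) g h : delta_fun gamma f [tuple g; h] =
  gamma g (f [tuple h]) - f [tuple (g * h)%g] + f [tuple g].
Proof.
have E n (s t : n.-tuple H) : (forall i, tnth s i = tnth t i) -> s = t.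
  exact: eq_from_tnth.
rewrite /delta_fun big_ord1.
have -> : drop_first [tuple g; h] = [tuple h].
  by apply: E => -[[|//] i]; rewrite tnth_mktuple !(tnth_nth 1%g).
have -> : drop_last [tuple g; h] = [tuple g].
  by apply: E => -[[|//] i]; rewrite tnth_mktuple !(tnth_nth 1%g).
have -> : contract ord0 [tuple g; h] = [tuple (g * h)%g].
  by apply: E => -[[|//] i]; rewrite tnth_mktuple !(tnth_nth 1%g).
by rewrite (tnth_nth 1%g) /= expr1 sqrrN expr1n mulrN1z mulr1z.
Qed.

Lemma tuple2E (t : 2.-tuple H) : t = [tuple tnth t 0; tnth t 1].
Proof. by apply: eq_from_tnth => -[[|[|//]] i]; rewrite !(tnth_nth 1%g). Qed.

Lemma tuple3E (t : 3.-tuple H) : t = [tuple tnth t 0; tnth t 1; tnth t 2].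
Proof. by apply: eq_from_tnth => -[[|[|[|//]]] i]; rewrite !(tnth_nth 1%g). Qed.

(** Converse of [cocycleE], by which a factor set becomes a cocycle. *)
Lemma ex_cocycle (f : H -> H -> N) :
  definable_map (fun p : H * H => f p.1 p.2) ->
  (forall g h k, gamma g (f h k) + f g (h * k)%g = f (g * h)%g k + f g h) ->
  exists c, cocycle_at c = f.
Proof.
move=> df fE; pose f2 (t : 2.-tuple H) := f (tnth t 0) (tnth t 1).
have df2 : f2 \in @definable_mapb _ _ H N 2.
  apply/asboolP.
  apply: (definable_comp df (f := fun t : 2.-tuple H => (tnth t 0, tnth t 1))).
  by apply: definable_pair; exact: definable_tnth.
have zf : Cochain df2 \in delta_kernel gamma (n := 2).
  apply/eqP/val_inj/funext => t /=.
  rewrite [t]tuple3E delta2E /= /f2 /= !(tnth_nth 1%g) /=.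
  by rewrite [X in X - _]addrAC fE addrAC addrK subrr.
exists (Cocycle zf); apply/funext => g; apply/funext => h.
by rewrite /cocycle_at /= /f2 !(tnth_nth 1%g).
Qed.

Lemma ex_factor_set E : o_minimal M -> exists c, factor_set E (cocycle_at c).
Proof.
move=> omin.
have [s ds sK] := definable_section omin (ext_out_definable E)
  (@ext_out_surj _ _ _ _ _ E).
have fib (p : H * H) : exists a, (s p.1 * s p.2)%g = (ext_in E a * s (p.1 * p.2))%g.
  by apply: ext_fiber; rewrite ext_outM !sK.
have [f fP] := choice fib.
have fM g h : (s g * s h = ext_in E (f (g, h)) * s (g * h))%g by exact: (fP (g, h)).
have [||c cE] := @ex_cocycle (fun g h => f (g, h)).
- have -> : (fun p : H * H => f (p.1, p.2)) = f by apply/funext => -[].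
  rewrite /definable_map.
  (* The values of [f] come from plain choice, but each is the only solution of this equation, so
     the graph is definable. *)
  have -> : [set q | f q.1 = q.2] = [set q : (H * H) * N |
      (s q.1.1 * s q.1.2)%g = (ext_in E q.2 * s (q.1.1 * q.1.2))%g].
    apply/seteqP; split=> -[p a] /=; first by move=> <-.
    by rewrite fP => /mulIg/ext_in_inj.
  have d1 : definable_map (fun q : (H * H) * N => q.1.1).
    exact: (definable_comp (@definable_fst _ _ _ _) (@definable_fst _ _ _ _)).
  have d2 : definable_map (fun q : (H * H) * N => q.1.2).
    exact: (definable_comp (@definable_snd _ _ _ _) (@definable_fst _ _ _ _)).
  apply: definable_set_eq;
    apply: (definable_comp (@definable_mulg _ _ _) (definable_pair _ _)).
  + exact: definable_comp ds d1.
  + exact: definable_comp ds d2.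
  + exact: (definable_comp (ext_in_definable E) (@definable_snd _ _ _ _)).
  apply: (definable_comp ds).
  apply: (definable_comp (@definable_mulg _ _ _) (definable_pair d1 d2)).
- move=> g h k; apply: (@ext_in_inj _ _ _ _ _ E).
  (* After multiplication by [s(ghk)], both sides are [s(g) s(h) s(k)], bracketed in the two
     ways. *)
  apply: (@mulIg _ (s (g * h * k)%g)).
  rewrite [in RHS]addrC !ext_inD -[RHS]mulgA -fM [RHS]mulgA -fM.
  rewrite -[LHS]mulgA -(mulgA g h k) -fM [LHS]mulgA -{1}(sK g) -ext_comm.
  by rewrite -!mulgA -fM.
by exists c, s; split=> // g h; rewrite cE.
Qed.

Lemma cohomologous_factor_set c d : c - d \in @coboundary _ _ _ _ gamma 2 <->
  factor_set (cocycle_extension d) (cocycle_at c).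
Proof.
(* In the factor set equation both sides have second coordinate [gh]; the first coordinates agree
   exactly when [c - d] is the coboundary of the first coordinate of [s]. *)
have key (s : H -> twisted_product d) : (forall h, (s h).2 = h) ->
    (forall g h, (s g * s h = twisted_in d (cocycle_at c g h) * s (g * h))%g) <->
    (forall g h, c [tuple g; h] - d [tuple g; h] =
       gamma g (s h).1 - (s (g * h)%g).1 + (s g).1).
  move=> s2; suff E g h : (s g * s h = twisted_in d (cocycle_at c g h) * s (g * h))%g <->
      c [tuple g; h] - d [tuple g; h] = gamma g (s h).1 - (s (g * h)%g).1 + (s g).1.
    by split=> e g h; apply/E.
  have -> : (s g * s h)%g =
      ((s g).1 + gamma g (s h).1 + d [tuple g; h], (g * h)%g) :> twisted_product d.
    by congr pair; rewrite /= ?s2.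
  have -> : (twisted_in d (cocycle_at c g h) * s (g * h))%g =
      (c [tuple g; h] + (s (g * h)%g).1, (g * h)%g) :> twisted_product d.
    congr pair; rewrite /= ?s2 ?mul1g // dact1 cocycle1g.
    by rewrite addrAC addrNK.
  split=> [[e]|e].
    have -> : c [tuple g; h] =
        (s g).1 + gamma g (s h).1 + d [tuple g; h] - (s (g * h)%g).1.
      by rewrite e addrK.
    by rewrite addrAC addrK [RHS]addrC addrA.
  have -> : c [tuple g; h] = gamma g (s h).1 - (s (g * h)%g).1 + (s g).1 + d [tuple g; h].
    by rewrite -e subrK.
  congr pair; rewrite [RHS]addrAC; congr (_ + _).
  by rewrite [RHS]addrAC addrNK addrC.
split=> [/asboolP[f fE]|[s [ds sK sM]]].
  exists (fun h => (f [tuple h], h) : twisted_product d); split=> //.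
  - apply: (@definable_pair _ _ _ N H); last exact: definable_id.
    apply: (definable_comp (cochain_definable f)).
    have -> : (fun h : H => [tuple h]) = (fun h => [tuple h | i < 1]).
      apply/funext => h; apply/eq_from_tnth => i.
      by rewrite tnth_mktuple (ord1 i) (tnth_nth 1%g).
    by apply: definable_mktuple => _; exact: definable_id.
  apply/key => // g h.
  by have := congr1 (fun f : cochain H N 2 => f [tuple g; h]) fE; rewrite /= delta1E.
apply/asboolP.
pose f1 (t : 1.-tuple H) := (s (tnth t 0)).1.
have df1 : f1 \in @definable_mapb _ _ H N 1.
  apply/asboolP.
  apply: (definable_comp (@definable_fst _ _ N H) (f := fun t => s (tnth t 0))).
  exact: (definable_comp ds (@definable_tnth _ _ _ _ _)).
exists (Cochain df1); apply/val_inj/funext => t; rewrite [t]tuple2E.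
move/(key _ sK): sM => sM.
by rewrite [RHS]delta1E /= /f1 !(tnth_nth 1%g) -sM.
Qed.

End Factor.

(** * The lexicographic order *)

Section Lexicographic.
Variables (R : rcfType) (M : expansion R).
Variables (H : definableGroupType M) (N : definableZmodType M).
Variable gamma : definable_action H N.
Variables (ltH : H -> H -> Prop) (ltN : N -> N -> Prop).

(** Maps into [N * H] make this applicable to the twisted product, which has the same encoding. *)
Lemma lex_definable (T : definableType M) (f g : T -> N * H) :
  ordered_group ltH -> ordered_zmodule ltN -> definable_map f -> definable_map g ->
  definable_set [set t | lex ltH ltN (f t) (g t)].
Proof.
move=> oH oN df dg.
have d1 := definable_pair (definable_comp (@definable_fst _ _ _ _) df)
  (definable_comp (@definable_fst _ _ _ _) dg).
have df2 := definable_comp (@definable_snd _ _ _ _) df.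
have dg2 := definable_comp (@definable_snd _ _ _ _) dg.
apply: definable_setU.
  exact: (definable_set_preim (definable_pair df2 dg2) (order_definable oH)).
apply: definable_setI; first exact: definable_set_eq.
exact: (definable_set_preim d1 (order_definable oN)).
Qed.

Lemma twisted_product_ordered (c : cocycle gamma 2) :
  ordered_group ltH -> ordered_zmodule ltN ->
  (forall h a b, ltN a b -> ltN (gamma h a) (gamma h b)) ->
  ordered_group (G := twisted_product c) (lex ltH ltN).
Proof.
move=> oH oN mono; split; rewrite /lex.
- by move=> x [/(order_irr oH)|[_ /(order_irr oN)]].
- move=> [a g] [b h] [d k] /= [gh|[-> ab]] [hk|[<- bd]].
  + by left; exact: (order_trans oH) gh hk.
  + by left.
  + by left.
  + by right; split=> //; exact: (order_trans oN) ab bd.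
- move=> [a g] [b h]; have [gh|<-|hg] := order_total oH g h.
  + by constructor 1; left.
  + have [ab|<-|ba] := order_total oN a b.
    * by constructor 1; right.
    * by constructor 2.
    * by constructor 3; right.
  + by constructor 3; left.
- move=> [d k] [a g] [b h] /= [gh|[<- ab]]; first by left; exact: (order_mull oH).
  (* Left multiplication by [(d, k)] takes [a] to [d + gamma k a + c(k, g)]: an order preserving
     automorphism followed by translations. *)
  by right; split=> //; apply: (order_mulr oN); apply: (order_mull oN); exact: mono.
- move=> [d k] [a g] [b h] /= [gh|[<- ab]]; first by left; exact: (order_mulr oH).
  by right; split=> //; do 2 apply: (order_mulr oN).
exact: (lex_definable oH oN (@definable_fst _ _ _ _) (@definable_snd _ _ _ _)).
Qed.

Lemma cocycle_extension_ordered (c : cocycle gamma 2) :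
  ordered_group ltH -> ordered_zmodule ltN ->
  (forall h a b, ltN a b -> ltN (gamma h a) (gamma h b)) ->
  lex_ordered_extension gamma ltH ltN (cocycle_extension c).
Proof.
move=> oH oN mono.
rewrite /lex_ordered_extension /=.
have -> : ext_lex (E := cocycle_extension c) ltH ltN = lex ltH ltN.
  by apply/funext => x; apply/funext => y; apply/propext; exact: cocycle_extension_lex.
exact: twisted_product_ordered.
Qed.

(** Both sides say that [c] is a factor set of the twisted product of [d]. *)
Lemma cohomology_classP (c d : cocycle gamma 2) :
  cohomology_class c = cohomology_class d <->
  ext_class (cocycle_extension c) = ext_class (cocycle_extension d).
Proof.
rewrite ext_classP -factor_setP -cohomologous_factor_set.
by rewrite Quotient.idealrBE; split=> [/eqP|/eqP].
Qed.

End Lexicographic.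

Theorem theorem3p10 (R : rcfType) (M : expansion R) (M_omin : o_minimal M)
    (H : definableGroupType M) (N : definableZmodType M)
    (ltH : H -> H -> Prop) (ltN : N -> N -> Prop)
    (H_ordered : ordered_group ltH) (N_ordered : ordered_zmodule ltN)
    (gamma : definable_action H N)
    (gamma_mono : forall (h : H) (a b : N),
       ltN a b -> ltN (gamma h a) (gamma h b)) :
  exists Phi : cohomology gamma 2 -> set (extension gamma),
    [/\ set_bij [set: cohomology gamma 2]
          [set ext_class E | E in lex_ordered_extension gamma ltH ltN] Phi,
        forall c : cocycle gamma 2,
          Phi (cohomology_class c) = ext_class (cocycle_extension c)
      & forall c : cocycle gamma 2,
          ordered_group (G := twisted_product c) (lex ltH ltN)].
Proof.
have ex_rep (q : cohomology gamma 2) : exists c, cohomology_class c = q.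
  by exists (repr q); rewrite /cohomology_class reprK.
have [rep repK] := choice ex_rep.
(* The map is defined on representatives; [cohomology_classP] gives both its independence of them
   and its injectivity. *)
exists (fun q => ext_class (cocycle_extension (rep q))).
have PhiE c : ext_class (cocycle_extension (rep (cohomology_class c))) =
    ext_class (cocycle_extension c).
  by apply/cohomology_classP; exact: repK.
split=> //; last by move=> c; exact: twisted_product_ordered.
split=> [q _|p q _ _ e|_ [E _ <-]].
- by exists (cocycle_extension (rep q)) => //; exact: cocycle_extension_ordered.
- by rewrite -(repK p) -(repK q); apply/cohomology_classP.
(* Surjectivity: the class of a factor set of [E] is sent to the class of [E]. *)
have [c /factor_setP/ext_classP e] := ex_factor_set E M_omin.
by exists (cohomology_class c); rewrite // PhiE.
Qed.
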